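(* Let $T>0$ and $H\in(0,1)\setminus\{1/2\}$. Define $c_0:=0$ if $H<1/2$ and $c_0:=HT^{2H-2}$ if $H>1/2$, and for $k\ge1$ $$c_k:=\begin{cases}\dfrac{2}{T}\displaystyle\int_0^T t^{2H}\cos\frac{k\pi t}{T}\,\mathrm{d}t, & H<1/2,\\[2mm] -\dfrac{4H(2H-1)T}{(k\pi)^2}\displaystyle\int_0^T t^{2H-2}\cos\frac{k\pi t}{T}\,\mathrm{d}t, & H>1/2.\end{cases}$$ Let $(Z_k)_{k\in\mathbb{Z}}$ be independent standard Gaussian random variables, and for $N\ge1$ and $t\in[0,T]$ let $$B_t^N=\sqrt{c_0}\,t\,Z_0+\sum_{k=1}^{N}\sqrt{-\frac{c_k}{2}}\left(Z_k\sin\frac{k\pi t}{T}+Z_{-k}\left(1-\cos\frac{k\pi t}{T}\right)\right),$$ and let $B_t$ denote the corresponding infinite series (i.e. the limit of $B_t^N$ as $N\to\infty$). Then, almost surely, $B^N$ converges uniformly on $[0,T]$ to $B$, and $$\mathbf{E}\sup_{t\in[0,T]}\left|B_t-B_t^N\right|\asymp N^{-H}\sqrt{\log N}.$$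
   Context: The coefficients satisfy $c_k\le0$ for $k\ge1$, so the square roots are real. The notation $a_N\asymp b_N$ means that there are constants $0<c\le C<\infty$ not depending on $N$ (they may depend on $H,T$) with $c\,b_N\le a_N\le C\,b_N$ for all $N\ge2$. *)

(* Defs.v *)
From mathcomp Require Import all_boot all_order all_algebra finmap.
From mathcomp Require Import all_classical all_reals all_analysis.

Set Implicit Arguments.
Unset Strict Implicit.
Unset Printing Implicit Defensive.

Import Order.TTheory GRing.Theory Num.Theory.
Import numFieldNormedType.Exports.

Local Open Scope classical_set_scope.
Local Open Scope ring_scope.

(* The joint law of every finite subfamily is a product. *)
Definition mutually_independent d (Omega : measurableType d) (R : realType)
    (P : probability Omega R) (I : choiceType) (X : I -> {RV P >-> R}) : Prop :=
  forall (J : {fset I}) (A : I -> set R), (forall i, measurable (A i)) ->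
    P (\bigcap_(i in [set` J]) (X i @^-1` A i)) =
    (\prod_(i <- J) P (X i @^-1` A i))%E.

(* The two set functions are compared on measurable sets only: a measure
   takes unspecified values on the other sets. *)
Definition standard_gaussian d (Omega : measurableType d) (R : realType)
    (P : probability Omega R) (X : {RV P >-> R}) : Prop :=
  forall A : set R, measurable A -> distribution P X A = normal_prob 0 1 A.

Section series.
Context {R : realType}.
Variables (T H : R).

(* At t = 0 the power t `^ (2 * H - 2) has an arbitrary value, on a null set.
   The case H = 1/2 falls in the last branch and is not meant to be used. *)
Definition coef (k : nat) : R :=
  if k is 0%N then
    if H < 2^-1 then 0 else H * T `^ (2 * H - 2)
  else
    if H < 2^-1 then
      2 / T * \int[lebesgue_measure]_(t in `[0, T])
                (t `^ (2 * H) * cos (k%:R * pi * t / T))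
    else
      - (4 * H * (2 * H - 1) * T / (k%:R * pi) ^+ 2) *
        \int[lebesgue_measure]_(t in `[0, T])
          (t `^ (2 * H - 2) * cos (k%:R * pi * t / T)).

Variables (Omega : Type) (Z : int -> Omega -> R).

Definition partial_process (N : nat) (t : R) (w : Omega) : R :=
  Num.sqrt (coef 0) * t * Z 0 w +
  \sum_(1 <= k < N.+1)
    Num.sqrt (- coef k / 2) *
      (Z k%:Z w * sin (k%:R * pi * t / T) +
       Z (- k%:Z) w * (1 - cos (k%:R * pi * t / T))).

(* [lim] is a default value wherever the series diverges. *)
Definition limit_process (t : R) (w : Omega) : R :=
  lim (partial_process N t w @[N --> \oo]).

(* sup over [0, T] of |B_t - B^N_t|, valued in [0, +oo]. *)
Definition sup_error (N : nat) (w : Omega) : \bar R :=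
  ereal_sup [set (`|limit_process t w - partial_process N t w|)%:E
            | t in `[0, T]].

End series.

(* Main.v *)
Require Import Defs.
From HB Require Import structures.
From mathcomp Require Import all_boot all_order all_algebra finmap.
From mathcomp Require Import all_classical all_reals all_analysis.
From mathcomp Require Import measurable_realfun ring lra zify.

(** Write [sigma_k] for the square root of [- c_k / 2].

    Size of the coefficients.  After rescaling, [c_k] is a constant times
    [k ^ (- 1 - 2 H)] times the integral of [f u * cos (pi u)] over [[0, k]],
    where [f] is a power of [u] with a sign that makes it convex and
    decreasing.  The cosine integrates to zero against affine functions over a
    full period and against constants over a half period.  Subtracting from
    [f] the chord through the two zeros of the cosine (respectively the value
    at the zero) makes the integrand nonnegative.  Hence the integrals over
    [[0, k]], [k >= 2], lie between those over [[0, 2]] and [[0, 1]], which are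
    positive, and [sigma_k] is comparable to [k ^ (- H - 1 / 2)]
    ([amplitude_bounds]).

    Probability enters only through the exponential moments of finite linear
    combinations of the [Z_k] ([integral_expR_gaussian_sum]); they follow from
    the product rule and the Gaussian moment generating function.

    Upper bound.  In the block of frequencies between [2 ^ j] and [2 ^ j.+1],
    a single random variable [block_bound] dominates all increments
    [B^n_t - B^(2 ^ j)_t], uniformly in [n] and [t] ([block_boundP]): a
    normalised sum of exponentials controls the maximum over [n] and over a
    grid of [4 ^ j] times, and a crude Lipschitz estimate controls the rest.
    Its mean is at most a constant times [sqrt (j + 1) * 2 ^ (- j H)]
    ([integral_block_bound]), because a maximum of polynomially many (in
    [2 ^ j]) Gaussian variables of standard deviation [2 ^ (- j H)] costs only
    a factor [sqrt j].  The tail sums of the [block_bound]s are therefore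
    almost surely finite, which gives uniform convergence, and the tail from
    [2 ^ m <= N] on bounds the error with the right mean
    ([integral_sup_error_le]).

    Lower bound.  At the times [t_i = i T / N], [0 < i < N], the vectors
    [(sin (k pi i / N))] with [N < k < 2 N] are orthogonal
    ([sum_sin_grid]).  Normalising them gives directions along which the
    Gaussian vector [Z] may be shifted by [lambda]; the shift is a change of
    measure with density [expR (lambda * U_i - lambda ^ 2 / 2)], where the
    [U_i] are uncorrelated.  It raises the mean of the error at [t_i] by a
    constant times [lambda * N ^ (- H)], which for large [lambda] exceeds the
    standard deviation, of order [N ^ (- H)].  So after averaging over [i] the
    event that some error exceeds a constant times [lambda * N ^ (- H)] is
    likely.  For [lambda ^ 2 = ln (N - 1)] plus a constant, the averaged
    density has a bounded second moment, so this event has probability bounded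
    below under the original measure as well ([tilted_union_ge],
    [grid_maximum_prob]).  *)

Set Implicit Arguments.
Unset Strict Implicit.
Unset Printing Implicit Defensive.

Import Order.TTheory GRing.Theory Num.Theory.
Import numFieldNormedType.Exports.

Local Open Scope classical_set_scope.
Local Open Scope ring_scope.

(** * Exponential moments of independent Gaussian variables *)

Section weighted_law.
Local Open Scope ereal_scope.
Context d d' (T : measurableType d) (T' : measurableType d') (R : realType).
Variables (mu : {measure set T -> \bar R}) (nu : {measure set T' -> \bar R}).
Variables (X : T -> T') (mX : measurable_fun [set: T] X).
Variables (g : T -> R) (mg : measurable_fun [set: T] g).
Hypothesis g0 : forall x, (0 <= g x)%R.
Variables (c : R) (c0 : (0 <= c)%R).
Hypothesis GX : forall A, measurable A ->
  \int[mu]_(x in X @^-1` A) (g x)%:E = c%:E * nu A.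

Let G (x : T) : \bar R := (g x)%:E.
Let mG : measurable_fun [set: T] G.
Proof. exact/measurable_EFinP. Qed.
Let G0 x : 0 <= G x.
Proof. by rewrite lee_fin. Qed.

Import HBNNSimple.

Let weighted_nnsfun (h : {nnsfun T' >-> R}) :
  \int[mu]_x (G x * (h (X x))%:E) = c%:E * \int[nu]_y (h y)%:E.
Proof.
have mhX r : measurable (X @^-1` (h @^-1` [set r])).
  by rewrite -[X in measurable X]setTI; exact: mX.
transitivity (\sum_(r \in range h)
    \int[mu]_x (G x * (r * \1_(X @^-1` (h @^-1` [set r])) x)%:E)).
  rewrite -ge0_integral_fsum//; last 2 first.
  - move=> r; apply: emeasurable_funM => //; apply/measurable_EFinP.
    exact: measurable_funM.
  - by move=> r x _; rewrite mule_ge0// nnfun_muleindic_ge0.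
  apply: eq_integral => x _; rewrite [in LHS]fimfunE -fsumEFin//.
  by rewrite ge0_mule_fsumr// => r; rewrite nnfun_muleindic_ge0.
transitivity (\sum_(r \in range h) (c%:E * (r%:E * nu (h @^-1` [set r])))).
  apply: eq_fsbigr => r /[!inE] -[y _ <-].
  have hy0 : (0 <= h y)%R by [].
  rewrite (_ : (fun x => _) =
    (fun x => (h y)%:E * (G \_ (X @^-1` (h @^-1` [set h y]))) x)); last first.
    apply/funext => x; rewrite EFinM muleCA; congr (_ * _).
    rewrite patchE indicE; case: ifP => _; first by rewrite mule1.
    by rewrite mule0.
  rewrite ge0_integralZl//=; last 2 first.
    - by apply/(measurable_restrictT _ _).1 => //; exact: measurable_funTS.
    - by move=> x _; exact: erestrict_ge0.
  by rewrite -integral_mkcond GX// muleCA.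
rewrite -ge0_mule_fsumr; last first.
  move=> r; have [r0|r0] := leP 0%R r; first by rewrite mule_ge0// lee_fin.
  by rewrite preimage_nnfun0// measure0 mule0.
congr (_ * _); under [RHS]eq_integral do rewrite fimfunE -fsumEFin//.
rewrite ge0_integral_fsum//.
- apply: eq_fsbigr => r _; rewrite integralZl_indic_nnsfun//.
  by rewrite integral_indic// setIT.
- by move=> r; exact/measurable_EFinP/measurable_funM.
- by move=> r x _; rewrite nnfun_muleindic_ge0.
Qed.

(** If weighting by [g] multiplies the law of [X] by the constant [c], it
    multiplies the mean of every [f X] by [c].  For [g] a function of other
    coordinates this is how independence acts on expectations; for [X] the
    identity and [g] a density it computes integrals against a law. *)
Lemma ge0_integral_weighted_law (f : T' -> \bar R) :
  measurable_fun [set: T'] f -> (forall y, 0 <= f y) ->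
  \int[mu]_x ((g x)%:E * f (X x)) = c%:E * \int[nu]_y f y.
Proof.
move=> mf f0; pose f_ := nnsfun_approx measurableT mf.
have f_cvg y : (f_ n y)%:E @[n --> \oo] --> f y by exact: cvg_nnsfun_approx.
have f_nd y : {homo (fun n => (f_ n y)%:E) : m n / (m <= n)%N >-> m <= n}.
  by move=> m n mn; rewrite lee_fin; exact/lefP/nd_nnsfun_approx.
rewrite -ge0_integralZl//.
transitivity (limn (fun n => \int[mu]_x (G x * (f_ n (X x))%:E))).
  rewrite -monotone_convergence//.
  - apply: eq_integral => x _; apply/esym/cvg_lim => //.
    exact: cvgeZl.
  - move=> n; apply: emeasurable_funM => //.
    by apply/measurable_EFinP; exact: measurableT_comp.
  - by move=> n x _; rewrite mule_ge0// lee_fin.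
  - by move=> x _ m n mn; rewrite lee_wpmul2l//; exact: f_nd.
transitivity (limn (fun n => c%:E * \int[nu]_y (f_ n y)%:E)).
  by congr (limn _); apply/funext => n; exact: weighted_nnsfun.
transitivity (limn (fun n => \int[nu]_y (c%:E * (f_ n y)%:E))).
  congr (limn _); apply/funext => n; rewrite ge0_integralZl//.
  - exact/measurable_EFinP.
  - by move=> y _; rewrite lee_fin.
rewrite -monotone_convergence//.
- by apply: eq_integral => y _; apply/cvg_lim => //; exact: cvgeZl.
- by move=> n; apply: measurable_funeM; exact/measurable_EFinP.
- by move=> n x _; rewrite mule_ge0// lee_fin.
- by move=> x _ m n mn; rewrite lee_wpmul2l//; exact: f_nd.
Qed.

End weighted_law.

Section normal_mgf.
Context (R : realType).
Local Open Scope ereal_scope.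

(** Completing the square turns [expR (a * x)] times the standard normal density
    into [expR (a ^+ 2 / 2)] times the normal density of mean [a]. *)
Lemma integral_expR_normal (nu : {measure set R -> \bar R}) (a : R) :
  (forall A : set R, measurable A -> nu A = normal_prob 0 1 A) ->
  \int[nu]_x (expR (a * x))%:E = (expR (a ^+ 2 / 2))%:E.
Proof.
move=> nuE; have mE : measurable_fun [set: R] (fun x => expR (a * x)).
  by apply: measurableT_comp => //; exact: measurable_funM.
rewrite -[LHS]mul1e.
rewrite -(@ge0_integral_weighted_law _ _ (measurableTypeR R) R R lebesgue_measure nu id _ (normal_pdf 0 1) _ _ 1%R)//.
- transitivity (\int[lebesgue_measure]_x ((expR (a ^+ 2 / 2))%:E * (normal_pdf a 1 x)%:E)).
    apply: eq_integral => x _; rewrite -!EFinM !normal_pdfE ?oner_eq0//.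
    rewrite /normal_fun mulrCA -mulrA; congr (_ * _)%:E.
    by rewrite -!expRD; congr expR; field.
  rewrite ge0_integralZl//.
  + by rewrite integral_normal_pdf mule1.
  + by apply/measurable_EFinP; exact: measurable_normal_pdf.
  + by move=> x _; rewrite lee_fin normal_pdf_ge0.
- exact: measurable_normal_pdf.
- by move=> x; exact: normal_pdf_ge0.
- by move=> A mA; rewrite mul1e nuE.
- exact/measurable_EFinP.
Qed.

End normal_mgf.

Section independence.
Context d (Omega : measurableType d) (R : realType) (P : probability Omega R).
Context (I : choiceType) (X : I -> {RV P >-> R}).
Hypothesis indepX : mutually_independent X.

(** The product rule for events gives the product rule for expectations by
    replacing the indicators with the [f i] one index at a time: the functions
    already replaced, times the remaining indicators, form the weight. *)
Lemma independent_integral_prod (s : seq I) (f : I -> R -> R) (e : I -> R) :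
  uniq s -> (forall i, measurable_fun [set: R] (f i)) ->
  (forall i x, 0 <= f i x) ->
  (forall i, \int[P]_w (f i (X i w))%:E = (e i)%:E)%E ->
  (\int[P]_w (\prod_(i <- s) f i (X i w))%:E = (\prod_(i <- s) e i)%:E)%E.
Proof.
move=> us mf f0 fe.
have e0 i : 0 <= e i.
  by rewrite -lee_fin -fe; apply: integral_ge0 => w _; rewrite lee_fin.
have mI (A : I -> set R) (i : I) : measurable (A i) ->
    measurable_fun [set: R] (\1_(A i) : R -> R) by exact: measurable_indic.
(* [s1] lists the indices already carrying [f i], [s2] those still carrying an indicator *)
suff gen (s1 s2 : seq I) (A : I -> set R) : uniq (s1 ++ s2) ->
    (forall i, measurable (A i)) ->
    (\int[P]_w (\prod_(i <- s1) f i (X i w) *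
                \prod_(i <- s2) \1_(A i) (X i w))%:E =
     (\prod_(i <- s1) e i)%:E * \prod_(i <- s2) P (X i @^-1` A i))%E.
  have := gen s [::] (fun=> setT); rewrite cats0 => /(_ us) h.
  rewrite -[RHS]mule1; have := h (fun=> measurableT); rewrite !big_nil => <-.
  by apply: eq_integral => w _; rewrite big_nil mulr1.
elim: s1 s2 A => [|i s1 IH] s2 A.
  rewrite /= => us2 mA; under eq_integral do rewrite big_nil mul1r.
  rewrite big_nil mul1e.
  have -> : (\prod_(i <- s2) P (X i @^-1` A i) =
    P (\bigcap_(i in [set` [fset i in s2]%fset]) (X i @^-1` A i)))%E.
    rewrite indepX//; apply: perm_big; rewrite uniq_perm//.
    by move=> i; rewrite in_fset/=.
  have mX i : measurable (X i @^-1` A i) by rewrite -[X in measurable X]setTI; exact: measurable_funP.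
  rewrite -[in RHS](setIT (\bigcap_(i in _) _)) -integral_indic//; last first.
    exact: fin_bigcap_measurable.
  apply: eq_integral => w _; congr EFin.
  rewrite indicE; have [/set_mem h|/negP h] := boolP (w \in _).
    rewrite big_seq big1// => i is2; rewrite indicE mem_set//.
    by apply: h => /=; rewrite in_fset.
  apply/eqP; rewrite prodf_seq_eq0; apply/hasP.
  apply: contrapT => h2; apply: h; apply/mem_set => i /=.
  rewrite in_fset/= => is2; apply: contrapT => h3; apply: h2.
  by exists i => //=; rewrite indicE memNset.
rewrite cat_cons cons_uniq => /andP[]; rewrite mem_cat => /norP[is1 is2] us12 mA.
pose g w := \prod_(j <- s1) f j (X j w) * \prod_(j <- s2) \1_(A j) (X j w).
have g0 w : 0 <= g w by rewrite mulr_ge0// prodr_ge0.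
have mg : measurable_fun [set: Omega] g.
  rewrite /g; apply: measurable_funM.
    by apply: measurable_prod => j _; apply: (measurableT_comp (mf j)).
  by apply: measurable_prod => j _; apply: (measurableT_comp (mI _ _ (mA j))).
have c0 : (0 <= (\prod_(j <- s1) e j)%:E * \prod_(j <- s2) P (X j @^-1` A j))%E.
  by rewrite mule_ge0 ?lee_fin ?prodr_ge0// prode_ge0.
have cfin : ((\prod_(j <- s1) e j)%:E * \prod_(j <- s2) P (X j @^-1` A j))%E \is a fin_num.
  rewrite fin_numM// prode_fin_num// => j _; apply: fin_num_measure.
  by rewrite -[X in measurable X]setTI; exact: measurable_funP.
transitivity (\int[P]_w ((g w)%:E * (f i (X i w))%:E))%E.
  by apply: eq_integral => w _; rewrite -EFinM big_cons /g [in RHS]mulrC mulrA.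
rewrite (@ge0_integral_weighted_law _ _ _ _ _ P (distribution P (X i)) (X i) _ _ mg g0
   (fine ((\prod_(j <- s1) e j)%:E * \prod_(j <- s2) P (X j @^-1` A j)))
   _ _ (fun y => (f i y)%:E))//.
- rewrite ge0_integral_distribution//; last 2 first.
    exact/measurable_EFinP.
  by move=> y; rewrite lee_fin.
  rewrite fineK// big_cons /= fe EFinM muleC muleA; congr (_ * _)%E.
- exact: fine_ge0.
- move=> B mB.
  pose A' j := if j == i then B else A j.
  have := IH (i :: s2) A'; rewrite uniq_catC cons_uniq mem_cat negb_or is1 is2.
  rewrite uniq_catC us12 => /(_ isT) h.
  rewrite fineK// integral_mkcond -muleA.
  rewrite (_ : _ * distribution _ _ _ = \prod_(j <- i :: s2) P (X j @^-1` A' j))%E; last first.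
    rewrite big_cons /A' eqxx muleC; congr (_ * _)%E.
    by apply: eq_big_seq => j js2; case: eqP => // ji; move: is2; rewrite -ji js2.
  rewrite -h; last by move=> j; rewrite /A'; case: ifP.
  apply: eq_integral => w _; rewrite patchE /g big_cons {1}/A' eqxx indicE.
  rewrite (_ : (w \in X i @^-1` B) = (X i w \in B)) ?mem_setE//.
  case: ifP => _; rewrite ?mul0r ?mulr0// mul1r; congr (_ * _)%:E.
  by apply: eq_big_seq => j js2; rewrite /A'; case: eqP => // ji; move: is2; rewrite -ji js2.
- exact/measurable_EFinP.
- by move=> y; rewrite lee_fin.
Qed.

End independence.

Section gaussian_family.
Context d (Omega : measurableType d) (R : realType) (P : probability Omega R).
Variable Z : int -> {RV P >-> R}.

(** The general finite linear combination of the family, with [a] acting on the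
    positive indices and [b] on the negative ones, as in the sine and cosine
    parts of the process. *)
Definition gaussian_sum (a b : nat -> R) (m n : nat) (w : Omega) : R :=
  \sum_(m <= k < n) (a k * Z k%:Z w + b k * Z (- k%:Z) w).

Lemma measurable_gaussian_sum a b m n :
  measurable_fun [set: Omega] (gaussian_sum a b m n).
Proof.
apply: measurable_sum => k.
by apply: measurable_funD; apply: measurable_funM.
Qed.

Lemma gaussian_sumD a b a' b' m n w :
  gaussian_sum (fun k => a k + a' k) (fun k => b k + b' k) m n w =
  gaussian_sum a b m n w + gaussian_sum a' b' m n w.
Proof. by rewrite /gaussian_sum -big_split; apply: eq_bigr => k _ /=; ring. Qed.

Lemma gaussian_sumZ l a b m n w :
  gaussian_sum (fun k => l * a k) (fun k => l * b k) m n w =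
  l * gaussian_sum a b m n w.
Proof. by rewrite /gaussian_sum mulr_sumr; apply: eq_bigr => k _ /=; ring. Qed.

Hypothesis indepZ : mutually_independent Z.
Hypothesis gaussZ : forall k, standard_gaussian (Z k).

Lemma integral_expR_gaussian k (l : R) :
  (\int[P]_w (expR (l * Z k w))%:E = (expR (l ^+ 2 / 2))%:E)%E.
Proof.
have mE : measurable_fun [set: R] (fun x => (expR (l * x))%:E).
  by apply/measurable_EFinP; apply: measurableT_comp => //; exact: measurable_funM.
rewrite -(integral_expR_normal l (gaussZ k)) ge0_integral_distribution//.
Qed.


Lemma integral_expR_gaussian_sum a b m n : (0 < m)%N ->
  (\int[P]_w (expR (gaussian_sum a b m n w))%:E =
   (expR (\sum_(m <= k < n) (a k ^+ 2 + b k ^+ 2) / 2))%:E)%E.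
Proof.
move=> m0.
(* for [k > 0] the integer [- k%:Z] is [Negz k.-1], whence the shift *)
pose c (z : int) := match z with Posz k => a k | Negz k => b k.+1 end.
pose s := [seq k%:Z | k <- index_iota m n] ++ [seq - k%:Z | k <- index_iota m n].
have cN k : (m <= k)%N -> c (- k%:Z) = b k.
  by move=> mk; case: k mk => // mk; move: m0; rewrite ltnNge mk.
have us : uniq s.
  rewrite cat_uniq !map_inj_uniq ?iota_uniq//=; last 2 first.
  - by move=> x y /oppr_inj[].
  - by move=> x y [].
  rewrite andbT; apply/hasPn => _ /mapP[k + ->].
  rewrite mem_index_iota => /andP[mk _]; apply/mapP => -[k' _].
  by case: k mk => // mk; move: m0; rewrite ltnNge mk.
have sumE (F : int -> R) : \sum_(i <- s) F i = \sum_(m <= k < n) (F k%:Z + F (- k%:Z)).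
  by rewrite big_split big_cat !big_map.
have -> : \sum_(m <= k < n) (a k ^+ 2 + b k ^+ 2) / 2 = \sum_(i <- s) c i ^+ 2 / 2.
  rewrite sumE; apply: eq_big_nat => k /andP[mk _].
  by rewrite cN//= mulrDl.
under eq_integral => w _.
  rewrite (_ : gaussian_sum _ _ _ _ _ = \sum_(i <- s) c i * Z i w); last first.
    by rewrite sumE; apply: eq_big_nat => k /andP[mk _]; rewrite cN.
  rewrite expR_sum.
  over.
rewrite expR_sum; apply: (independent_integral_prod indepZ us
  (f := fun i x => expR (c i * x))) => //.
- by move=> i; apply: measurableT_comp => //; exact: measurable_funM.
- by move=> i; exact: integral_expR_gaussian.
Qed.

End gaussian_family.

(** * Change of scale and integrals of powers *)

Section scaling.
Context (R : realType).
Notation mu := (@lebesgue_measure R).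

Lemma lebesgue_measure_scale (h : R) (A : set R) : 0 < h -> measurable A ->
  mu ((fun x => h * x) @^-1` A) = ((h^-1)%:E * mu A)%E.
Proof.
move=> h0 mA; pose X := (fun x : measurableTypeR R => h * x : measurableTypeR R).
have mX : measurable_fun [set: measurableTypeR R] X by exact: measurable_funM.
pose hn : {nonneg R} := NngNum (ltW h0).
have nuE : exists nu : {measure set measurableTypeR R -> \bar R},
    forall B, nu B = (h%:E * mu (X @^-1` B))%E.
  by unshelve eexists (mscale hn (pushforward mu X)).
case: nuE => nu nuE.
have -> : mu A = nu A.
  apply: (@lebesgue_measure_unique R nu) => // _ [[a b]] _ <- /=.
  rewrite nuE.
  have -> : X @^-1` `]a, b]%classic = `](a / h), (b / h)]%classic.
    by apply/seteqP; split => x /=; rewrite !in_itv/= /X ltr_pdivrMr// ler_pdivlMr// mulrC.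
  rewrite !lebesgue_measure_itv/= !lte_fin ltr_pM2r ?invr_gt0//.
  case: ifPn => _; last by rewrite mule0.
  by rewrite -!EFinD -EFinM -mulrBl mulrC divfK// gt_eqF.
rewrite nuE muleA -EFinM mulVf ?gt_eqF// mul1e.
by [].
Qed.

(** Stated for integrable functions, since the powers to which it applies may
    be singular at [0], which excludes substitution theorems for continuous
    integrands. *)
Lemma Rintegral_scale (h T : R) (f : R -> R) : 0 < h ->
  mu.-integrable `[0, T] (EFin \o f) ->
  \int[mu]_(x in `[0, T]) f x = h * \int[mu]_(x in `[0, T / h]) f (h * x).
Proof.
move=> h0 intf; pose g := (EFin \o f) \_ `[0, T]%classic.
have mg : measurable_fun [set: R] g.
  by apply/(measurable_restrictT _ _).1 => //; exact: measurable_int intf.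
have scale (F : R -> \bar R) : measurable_fun [set: R] F -> (forall x, 0 <= F x)%E ->
    (\int[mu]_x F (h * x)%R = (h^-1)%:E * \int[mu]_x F x)%E.
  move=> mF F0; rewrite -(@ge0_integral_weighted_law _ _ (measurableTypeR R)
    (measurableTypeR R) R mu mu (fun x => h * x) _ (cst 1))//.
  - by apply: eq_integral => x _; rewrite mul1e.
  - exact: measurable_funM.
  - by rewrite invr_ge0 ltW.
  - move=> A mA; rewrite -lebesgue_measure_scale// -[RHS]mul1e -integral_cst//.
    rewrite -[X in measurable X]setTI.
    have mX : measurable_fun [set: R] (fun x : R => h * x) by exact: measurable_funM.
    exact: mX.
have intg : mu.-integrable setT g.
  by apply/(integrable_mkcond _ _).1.
rewrite /Rintegral integral_mkcond [in RHS]integral_mkcond.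
have -> : (fun x => (f (h * x))%:E) \_ `[0, (T / h)]%classic = g \o (fun x => h * x).
  apply/funext => x; rewrite /g /= !patchE; congr (if _ then _ else _).
  rewrite !mem_setE !in_itv/=; rewrite pmulr_rge0// ler_pdivlMr// mulrC.
  by [].
rewrite -/g [in LHS]integralE [in RHS]integralE.
have pE : (\int[mu]_x ((g \o *%R h)^\+ x) = (h^-1)%:E * \int[mu]_x (g^\+ x))%E.
  by rewrite funepos_comp -(scale _ (measurable_funepos mg) (funepos_ge0 g)).
have nE : (\int[mu]_x ((g \o *%R h)^\- x) = (h^-1)%:E * \int[mu]_x (g^\- x))%E.
  by rewrite funeneg_comp -(scale _ (measurable_funeneg mg) (funeneg_ge0 g)).
rewrite pE nE.
have pfin := integrable_pos_fin_num measurableT intg.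
have nfin := integrable_neg_fin_num measurableT intg.
rewrite -(fineK pfin) -(fineK nfin) -!EFinM -!EFinB /= -mulrBr mulrA.
by rewrite mulfV ?mul1r// gt_eqF.
Qed.

End scaling.

Section calculus.
Context (R : realType).
Notation mu := (@lebesgue_measure R).

Lemma integral_is_derive (f F : R -> R) (a b : R) : a <= b ->
  (forall x, a <= x <= b -> is_derive x 1 F (f x)) ->
  {within `[a, b], continuous f} ->
  (\int[mu]_(x in `[a, b]) (f x)%:E = (F b - F a)%:E)%E.
Proof.
rewrite le_eqVlt => /predU1P[<- _ _|ab dF cf].
  by rewrite set_itv1 integral_set1 subrr.
have cF x : a <= x <= b -> F @ x --> F x.
  move=> /dF dFx; apply: differentiable_continuous.
  by apply/derivable1_diffP; exact: ex_derive.
rewrite EFinB; apply: continuous_FTC2 => //.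
- split.
  + by move=> x /[!in_itv]/= /andP[ax xb]; have := dF x; rewrite !ltW// => /(_ isT)[].
  + by apply: cvg_at_right_filter; apply: cF; rewrite lexx ltW.
  + by apply: cvg_at_left_filter; apply: cF; rewrite lexx ltW.
- move=> x /[!in_itv]/= /andP[ax xb]; rewrite derive1E.
  by have := dF x; rewrite !ltW// => /(_ isT) dFx; rewrite derive_val.
Qed.

Lemma continuous_powR_gt0 (a x : R) : 0 < x -> {for x, continuous (fun u : R => u `^ a)}.
Proof.
move=> x0; apply: differentiable_continuous; apply/derivable1_diffP.
by apply: derivable_powR; rewrite in_itv/= andbT.
Qed.

(** The integrals over [[c / n.+1, c]] are computed from an antiderivative and stay
    bounded as [n] grows, so monotone convergence applies. *)
Lemma integrable_powR (a c : R) : -1 < a -> 0 < c ->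
  mu.-integrable `[0, c] (EFin \o (fun u => u `^ a)).
Proof.
move=> a1 c0; have mp : measurable_fun [set: R] (fun u : R => (u `^ a)%:E).
  by apply/measurable_EFinP; exact: measurable_powR.
apply/integrableP; split; first exact: measurable_funTS.
have a10 : a + 1 != 0 by lra.
under eq_integral do rewrite /= ger0_norm ?powR_ge0//.
rewrite -integral_itv_obnd_cbnd; last exact: measurable_funTS.
pose I n := `[c / n.+1%:R, c]%classic.
have -> : `]0, c]%classic = \bigcup_n I n.
  apply/seteqP; split=> x; rewrite /I /=.
    rewrite in_itv/= => /andP[x0 xc].
    have := archi_boundP (ltW (divr_gt0 c0 x0)).
    set n := Num.bound _ => cn; exists n => //=; rewrite in_itv/= xc andbT.
    rewrite ler_pdivrMr ?ltr0n// mulrC -ler_pdivrMr//.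
    by rewrite (le_trans (ltW cn))// ler_nat.
  move=> [n _ /=]; rewrite !in_itv/= => /andP[cx ->]; rewrite andbT.
  by rewrite (lt_le_trans _ cx)// divr_gt0// ltr0n.
have mI n : measurable (I n) by exact: measurable_itv.
have := @ge0_nondecreasing_set_cvg_integral _ (measurableTypeR R) R I (fun u => (u `^ a)%:E) mu.
move=> /(_ _ mI (fun n => measurable_funTS mp)) cvgI.
have {}cvgI : (\int[mu]_(x in I n) (x `^ a)%:E @[n --> \oo] -->
  \int[mu]_(x in \bigcup_n I n) (x `^ a)%:E)%E.
  apply: cvgI => [m n mn|n x _]; last by rewrite lee_fin powR_ge0.
  rewrite subsetEset; apply: subset_itvr; rewrite bnd_simp.
  by rewrite ler_pM2l// lef_pV2 ?posrE ?ltr0n// ler_nat.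
apply: (@le_lt_trans _ _ (c `^ (a + 1) / (a + 1))%:E); last exact: ltry.
rewrite -(cvg_lim _ cvgI)//; apply: lime_le; first by apply/cvg_ex; eexists; exact: cvgI.
apply: nearW => n; have cn0 : 0 < c / n.+1%:R by rewrite divr_gt0// ltr0n.
have dF x : c / n.+1%:R <= x <= c ->
    is_derive x 1 ((a + 1)^-1 \*: (fun u : R => u `^ (a + 1))) (x `^ a).
  move=> /andP[cx _]; have x0 := lt_le_trans cn0 cx.
  have -> : x `^ a = (a + 1)^-1 *: ((a + 1) * x `^ (a + 1 - 1)).
    by rewrite /GRing.scale/= mulrA mulVf// mul1r addrK.
  by apply: is_deriveZ; exact: is_derive1_powR.
rewrite (integral_is_derive _ dF).
- rewrite lee_fin /GRing.scale/= lerBlDr mulrC lerDl mulr_ge0 ?powR_ge0//.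
  by rewrite invr_ge0; lra.
- by rewrite ler_pdivrMr ?ltr0n// ler_pMr// ler1n.
- apply: continuous_in_subspaceT => x; rewrite inE/= in_itv/= => /andP[cx _].
  exact: continuous_powR_gt0 (lt_le_trans cn0 cx).
Qed.

End calculus.

(** * Cosine integrals of convex decreasing functions *)

Section alternating.
Context (R : realType).
Notation mu := (@lebesgue_measure R).

Lemma sin_natpi (n : nat) : sin (pi * n%:R) = 0 :> R.
Proof.
elim: n => [|n IH]; first by rewrite mulr0 sin0.
by rewrite -natr1 mulrDr mulr1 sinDpi IH oppr0.
Qed.

Lemma cos_natpiD (n : nat) (v : R) : cos (pi * (n%:R + v)) = (-1) ^+ n * cos (pi * v).
Proof.
elim: n => [|n IH]; first by rewrite add0r mul1r.
by rewrite -natr1 addrAC mulrDr mulr1 cosDpi IH exprS mulN1r mulNr.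
Qed.

Lemma cos_natpi (n : nat) : cos (pi * n%:R) = (-1) ^+ n :> R.
Proof. by rewrite -[n%:R]addr0 cos_natpiD mulr0 cos0 mulr1. Qed.

Lemma cos_pi_first_quarter (v : R) : 0 <= v <= 2^-1 -> 0 <= cos (pi * v).
Proof.
move=> /andP[v0 v1]; have p0 := pi_gt0 R.
by apply: cos_ge0_pihalf; apply/andP; split; nra.
Qed.

Lemma cos_pi_middle (v : R) : 2^-1 <= v <= 3 / 2 -> cos (pi * v) <= 0.
Proof.
move=> /andP[v0 v1]; have p0 := pi_gt0 R.
rewrite -[v](subrK 1) addrC (cos_natpiD 1) expr1 mulN1r oppr_le0.
by apply: cos_ge0_pihalf; apply/andP; split; nra.
Qed.

Lemma cos_pi_last_quarter (v : R) : 3 / 2 <= v <= 2 -> 0 <= cos (pi * v).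
Proof.
move=> /andP[v0 v1]; have p0 := pi_gt0 R.
rewrite -[v](subrK 2) addrC (cos_natpiD 2) sqrrN expr1n mul1r.
by apply: cos_ge0_pihalf; apply/andP; split; nra.
Qed.

Lemma continuous_affine_cos (al be : R) :
  continuous (fun u : R => (al * u + be) * cos (pi * u)).
Proof.
move=> x; apply: cvgM; first by apply: cvgD; [apply: cvgM|]; [exact: cvg_cst|exact: cvg_id|exact: cvg_cst].
apply: (continuous_comp (g := @cos R)); last exact: continuous_cos.
by apply: cvgM; [exact: cvg_cst|exact: cvg_id].
Qed.

Lemma integrable_affine_cos (al be a b : R) :
  mu.-integrable `[a, b] (EFin \o (fun u : R => (al * u + be) * cos (pi * u))).
Proof.
apply: continuous_compact_integrable; first exact: segment_compact.
exact/continuous_subspaceT/continuous_affine_cos.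
Qed.

Lemma Rintegral_affine_cos (al be a b : R) : a <= b ->
  let F u := (al * u + be) * sin (pi * u) / pi + al * cos (pi * u) / pi ^+ 2 in
  \int[mu]_(u in `[a, b]) ((al * u + be) * cos (pi * u)) = F b - F a.
Proof.
have p0 : (pi : R) != 0 by rewrite gt_eqF// pi_gt0.
move=> ab F; have dF (x : R) : is_derive x 1 F ((al * x + be) * cos (pi * x)).
  have dl (c : R) : is_derive x 1 (fun u : R => c * u) c.
    have := is_deriveZ c (is_derive_id x (1 : R)).
    by rewrite /GRing.scale/= mulr1.
  have ds : is_derive x 1 (fun u => sin (pi * u)) (pi * cos (pi * x)).
    by rewrite mulrC; apply: is_derive1_comp.
  have dc : is_derive x 1 (fun u => cos (pi * u)) (pi * - sin (pi * x)).
    by rewrite mulrC; apply: is_derive1_comp.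
  have da : is_derive x 1 (fun u => al * u + be) (al + 0).
    exact: is_deriveD.
  have -> : F = ((fun u => al * u + be) * (fun u => sin (pi * u))) * cst (pi^-1) +
     (al / pi ^+ 2) \*: (fun u => cos (pi * u)).
    apply/funext => u; rewrite /F/= !fctE /GRing.scale/=; congr (_ + _).
    by rewrite mulrAC.
  apply: is_derive_eq; rewrite /GRing.scale/= mulr0 add0r.
  by move: (cos (pi * x)) (sin (pi * x)) => c s; move: (pi) p0 => q q0; field.
rewrite /Rintegral (integral_is_derive _ (fun x _ => dF x))//.
exact/continuous_subspaceT/continuous_affine_cos.
Qed.


Variable f : R -> R.
Hypothesis f_convex : forall x y z, 0 < x -> x < y -> y < z ->
  f y * (z - x) < f x * (z - y) + f z * (y - x).
Hypothesis f_decr : forall x y, 0 < x -> x <= y -> f y <= f x.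
Hypothesis f_int : forall c, 0 < c -> mu.-integrable `[0, c] (EFin \o f).

Let fc u := f u * cos (pi * u).

Let fc_int (a b : R) : 0 <= a -> mu.-integrable `]a, b] (EFin \o fc).
Proof.
move=> a0.
have [ba|ab] := leP b a.
  by rewrite set_itv_ge ?bnd_simp -?leNgt//; exact: integrable_set0.
have b0 := le_lt_trans a0 ab.
apply: (@integrableS _ _ _ mu `[0, b]%classic) => //.
  by apply: subset_itvr; rewrite bnd_simp.
have mc : measurable_fun [set: R] (fun u : R => cos (pi * u)).
  apply: continuous_measurable_fun => x.
  apply: (continuous_comp (g := @cos R)); last exact: continuous_cos.
  by apply: cvgM; [exact: cvg_cst|exact: cvg_id].
apply: (@integrableMl _ (measurableTypeR R) R mu `[0, b]%classic _
  (EFin \o f) (fun u => cos (pi * u))) => //.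
- exact: f_int.
- exact: measurable_funTS.
- by exists 1; split=> [|M M1 x _] /=; [exact: real1|exact: le_trans (cos_max _) (ltW M1)].
Qed.

Lemma Rintegral_cos_split (a b c : R) : 0 <= a -> a <= b -> b <= c ->
  \int[mu]_(u in `]a, c]) fc u =
  \int[mu]_(u in `]a, b]) fc u + \int[mu]_(u in `]b, c]) fc u.
Proof.
move=> a0 ab bc.
by rewrite -(@Rintegral_itvB _ fc (BRight a) (BRight c) b) ?bnd_simp//;
  [rewrite addrCA subrr addr0|exact: fc_int].
Qed.

(** The hypothesis on [al] says that the cosine integrates to zero against
    [al * u + be] over [[p, p + n]]: either [al = 0], or [n] is even. *)
Let sub_affine (p n : nat) (al be : R) :
  al * ((-1) ^+ (p + n) - (-1) ^+ p) = 0 ->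
  (-1) ^+ p * \int[mu]_(u in `]p%:R, (p + n)%:R]) fc u =
  \int[mu]_(u in `]p%:R, (p + n)%:R])
     ((f u - (al * u + be)) * ((-1) ^+ p * cos (pi * u))).
Proof.
move=> al0.
have ia : mu.-integrable `]p%:R, (p + n)%:R]
    (EFin \o (fun u => (al * u + be) * cos (pi * u))).
  apply: integrableS (integrable_affine_cos al be p%:R (p + n)%:R) => //.
  exact: subset_itv_oc_cc.
have ifc := fc_int (p + n)%:R (ler0n R p).
have int0 : \int[mu]_(u in `]p%:R, (p + n)%:R]) ((al * u + be) * cos (pi * u)) = 0.
  rewrite Rintegral_itv_obnd_cbnd// Rintegral_affine_cos ?ler_nat ?leq_addr//=.
  rewrite !sin_natpi !cos_natpi !mulr0 !mul0r !add0r -mulrBl -mulrBr al0 mul0r.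
  by [].
rewrite -[X in _ * X = _]subr0 -int0 -RintegralB// -RintegralZl//; last first.
  exact: integrableB ifc ia.
by apply: eq_Rintegral => u _; rewrite /fc; ring.
Qed.

Lemma Rintegral_cos_half_period_ge0 (p : nat) :
  0 <= (-1) ^+ p * \int[mu]_(u in `]p%:R, (p + 1)%:R]) fc u.
Proof.
rewrite (@sub_affine p 1 0 (f (p%:R + 2^-1))) ?mul0r//.
apply: Rintegral_ge0 => u; rewrite /= in_itv/= natrD => /andP[pu up].
have p0 : 0 <= p%:R :> R by exact: ler0n.
rewrite mul0r add0r -[u](subrK p%:R) (addrC (u - _)) cos_natpiD mulrA -expr2 sqrr_sign mul1r.
rewrite addrC subrK.
have [uh|hu] := leP u (p%:R + 2^-1).
  apply: mulr_ge0; first by rewrite subr_ge0; apply: f_decr => //; lra.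
  by apply: cos_pi_first_quarter; apply/andP; split; lra.
apply: mulr_le0; first by rewrite subr_le0; apply: f_decr; lra.
by apply: cos_pi_middle; apply/andP; split; lra.
Qed.

(** The chord of the convex function [f] through the two zeros of the cosine in
    [[p, p + 2]] lies below [f] outside these zeros and above it between them,
    which are also the places where the cosine has a constant sign. *)
Let chord_sign (p : nat) (u : R) (al := f (p%:R + 3 / 2) - f (p%:R + 2^-1))
    (be := f (p%:R + 2^-1) - al * (p%:R + 2^-1)) : p%:R < u <= p%:R + 2 ->
  0 <= (f u - (al * u + be)) * ((-1) ^+ p * cos (pi * u)).
Proof.
move=> /andP[pu up].
have p0 : 0 <= p%:R :> R by exact: ler0n.
rewrite -[in cos _](subrK p%:R u) (addrC (u - _)) cos_natpiD mulrA -expr2 sqrr_sign mul1r.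
rewrite /be /al.
have [uh|hu|->] := ltgtP u (p%:R + 2^-1); last first.
- by rewrite [X in X * _](_ : _ = 0) ?mul0r//; ring.
- have [uh2|hu2|->] := ltgtP u (p%:R + 3 / 2); last first.
  + by rewrite [X in X * _](_ : _ = 0) ?mul0r//; lra.
  + apply: mulr_ge0; last by apply: cos_pi_last_quarter; apply/andP; split; lra.
    have := @f_convex (p%:R + 2^-1) (p%:R + 3 / 2) u; nra.
  + apply: mulr_le0; last by apply: cos_pi_middle; apply/andP; split; lra.
    have := @f_convex (p%:R + 2^-1) u (p%:R + 3 / 2); nra.
- apply: mulr_ge0; last by apply: cos_pi_first_quarter; apply/andP; split; lra.
  have := @f_convex u (p%:R + 2^-1) (p%:R + 3 / 2); nra.
Qed.

Lemma Rintegral_cos_period_ge0 (p : nat) :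
  0 <= (-1) ^+ p * \int[mu]_(u in `]p%:R, (p + 2)%:R]) fc u.
Proof.
set al := f (p%:R + 3 / 2) - f (p%:R + 2^-1).
rewrite (@sub_affine p 2 al (f (p%:R + 2^-1) - al * (p%:R + 2^-1))).
  by apply: Rintegral_ge0 => u; rewrite /= in_itv/= natrD; exact: chord_sign.
by rewrite exprD sqrrN expr1n mulr1 subrr mulr0.
Qed.

(** Cut the interval into full periods and at most one half period. *)
Lemma Rintegral_cos_ge0 (n p : nat) :
  0 <= (-1) ^+ p * \int[mu]_(u in `]p%:R, (p + n)%:R]) fc u.
Proof.
have [m] := ubnP n; elim: m n p => // m IH [|[|n]] p nm.
- by rewrite addn0 set_itv_ge ?bnd_simp ?ltxx// Rintegral_set0 mulr0.
- exact: Rintegral_cos_half_period_ge0.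
- rewrite (@Rintegral_cos_split _ (p + 2)%:R) ?ler_nat ?leq_addr//; last first.
    by rewrite leq_add2l.
  rewrite mulrDr addr_ge0 ?Rintegral_cos_period_ge0//.
  have := IH n (p + 2)%N; rewrite exprD sqrrN expr1n mulr1 -addnA.
  by rewrite add2n; apply; lia.
Qed.

Lemma Rintegral_cos_le1 (k : nat) : (0 < k)%N ->
  \int[mu]_(u in `]0, k%:R]) fc u <= \int[mu]_(u in `]0, 1]) fc u.
Proof.
case: k => // k _; rewrite (@Rintegral_cos_split _ 1)// ?ler1n// gerDl.
by have := Rintegral_cos_ge0 k 1; rewrite expr1 mulN1r oppr_ge0 add1n.
Qed.

Lemma Rintegral_cos_ge2 (k : nat) : (2 <= k)%N ->
  \int[mu]_(u in `]0, 2]) fc u <= \int[mu]_(u in `]0, k%:R]) fc u.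
Proof.
move=> k2; rewrite [leRHS](@Rintegral_cos_split _ 2)// ?ler_nat// lerDl.
by have := Rintegral_cos_ge0 (k - 2) 2; rewrite sqrrN expr1n mul1r subnKC.
Qed.

(** The integrand obtained by subtracting the chord is nonnegative, and on
    [[1/8, 1/4]] it is bounded below by a constant [m], positive by strict
    convexity. *)
Lemma Rintegral_cos2_gt0 : 0 < \int[mu]_(u in `]0, 2]) fc u.
Proof.
set al := f (0%:R + 3 / 2) - f (0%:R + 2^-1).
set be := f (0%:R + 2^-1) - al * (0%:R + 2^-1).
have := @sub_affine 0 2 al be; rewrite /= !expr0 !mul1r add0n => ->; last first.
  by rewrite sqrrN expr1n subrr mulr0.
pose m := (f 4^-1 - (al * 4^-1 + be)) * cos (pi * 4^-1).
have p0 := pi_gt0 R.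
have alE : al = f (3 / 2) - f 2^-1 by rewrite /al !add0r.
have beE : be = f 2^-1 - al * 2^-1 by rewrite /be !add0r.
have sub (u : R) : 8^-1 <= u -> u <= 4^-1 -> 0 < u <= 2.
  by move=> u1 u2; apply/andP; split; lra.
have m0 : 0 < m.
  apply: mulr_gt0; last by apply: cos_gt0_pihalf; apply/andP; split; nra.
  have := @f_convex 4^-1 2^-1 (3 / 2); rewrite beE alE; nra.
have i1 : mu.-integrable `]0, 2] (EFin \o (\1_`[8^-1, 4^-1] : R -> R)).
  by apply: integrableS (integrable_indic_itv _ _ _ _) => //.
have mE : m * 8^-1 = \int[mu]_(u in `]0, 2]) (m * \1_`[8^-1, 4^-1] u).
  rewrite RintegralZl//.
  congr (_ * _); rewrite /Rintegral integral_indic//= setIidl; last first.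
    by move=> u; rewrite /= !in_itv/= => /andP[u1 u2]; exact: sub.
  have lt84 : (8^-1 : R) < 4^-1 by lra.
  rewrite lebesgue_measure_itv/= lte_fin lt84 -EFinB/=.
  have -> : (4^-1 - 8^-1 = 8^-1 :> R) by lra.
  by [].
apply: (@lt_le_trans _ _ (m * 8^-1)); first by rewrite mulr_gt0.
rewrite mE; apply: le_Rintegral => //.
- apply: (@integrableZl _ (measurableTypeR R) R mu _ _ m (EFin \o \1_`[8^-1, 4^-1])) => //.
- have ia : mu.-integrable `]0, 2] (EFin \o (fun u => (al * u + be) * cos (pi * u))).
    apply: integrableS (integrable_affine_cos al be 0 2) => //.
    exact: subset_itv_oc_cc.
  have ifc := fc_int 2 (lexx 0).
  have : mu.-integrable `]0, 2] ((EFin \o fc) \-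
      (EFin \o (fun u : R => (al * u + be) * cos (pi * u))%R))%E.
    exact: integrableB ifc ia.
  apply: eq_integrable => // u _ /=; rewrite -EFinB; congr EFin.
  by rewrite /fc; ring.
- move=> u; rewrite /= in_itv/= => /andP[u0 u2].
  have := @chord_sign 0 u; rewrite /= expr0 mul1r add0r u0 u2 -/al -/be => /(_ isT) g0.
  rewrite indicE; have [|_] := boolP (u \in _); last by rewrite mulr0.
  rewrite mem_setE in_itv/= mulr1 => /andP[u8 u4].
  apply: ler_pM.
  + have := @f_convex 4^-1 2^-1 (3 / 2); rewrite beE alE; nra.
  + by apply/ltW/cos_gt0_pihalf; apply/andP; split; nra.
  (* by convexity the gap between [f] and its chord decreases on the left of the first zero *)
  + have [->//|u4'] := eqVneq u 4^-1; have {}u4' : u < 4^-1 by rewrite lt_neqAle u4' u4.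
    have := @f_convex 4^-1 2^-1 (3 / 2); have := @f_convex u 4^-1 2^-1.
    rewrite beE alE; nra.
  + rewrite leNgt ltr_cos ?in_itv/=; [|apply/andP; split; nra|apply/andP; split; nra].
    rewrite -leNgt; nra.
Qed.

End alternating.

(** * Size of the coefficients *)

Section power_coefficients.
Context (R : realType).
Notation mu := (@lebesgue_measure R).

Section signed_power.
Variables (e a : R).
Hypotheses (ea_lt0 : e * a < 0) (a_lt1 : a < 1).
Let f (u : R) := e * u `^ a.

Let f_MVT (x y : R) : 0 < x -> x < y ->
  exists2 c, x < c < y & f y - f x = e * a * c `^ (a - 1) * (y - x).
Proof.
move=> x0 xy.
have df (c : R) : 0 < c -> is_derive c 1 f (e * a * c `^ (a - 1)).
  move=> c0; rewrite -mulrA; have := is_derive1_powR a c0.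
  by move=> /(is_deriveZ e).
have [||c] := @MVT R f (fun c => e * a * c `^ (a - 1)) x y xy.
- by move=> c; rewrite in_itv/= => /andP[xc _]; apply: df; exact: lt_trans xc.
- apply: continuous_in_subspaceT => c; rewrite inE/= in_itv/= => /andP[xc _].
  apply: differentiable_continuous; apply/derivable1_diffP.
  by have /df[] := lt_le_trans x0 xc.
- by rewrite in_itv/= => xcy E; exists c.
Qed.

Lemma signed_powR_decr (x y : R) : 0 < x -> x <= y -> f y <= f x.
Proof.
move=> x0; rewrite le_eqVlt => /predU1P[->//|xy].
have [c /andP[xc _] E] := f_MVT x0 xy.
have c0 := powR_gt0 (a - 1) (lt_trans x0 xc).
rewrite -subr_le0 E; apply: mulr_le0_ge0; last by rewrite subr_ge0 ltW.
by apply: mulr_le0_ge0; exact: ltW.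
Qed.

(** Strict convexity in the three-point form: the mean value theorem on both
    sides of [y], and strict monotonicity of [u `^ (a - 1)]. *)
Lemma signed_powR_convex (x y z : R) : 0 < x -> x < y -> y < z ->
  f y * (z - x) < f x * (z - y) + f z * (y - x).
Proof.
move=> x0 xy yz; have y0 := lt_trans x0 xy.
have [c /andP[xc cy] E] := f_MVT x0 xy.
have [c' /andP[yc' _] E'] := f_MVT y0 yz.
have c0 := lt_trans x0 xc.
have cc' := lt_trans cy yc'; have c'0 := lt_trans c0 cc'.
have cpow : c' `^ (a - 1) < c `^ (a - 1).
  rewrite -(opprB 1 a) !powRN ltf_pV2 ?posrE ?powR_gt0//.
  have a0 : 0 < 1 - a by rewrite subr_gt0.
  by apply: (gt0_ltr_powR a0) => //; rewrite nnegrE ltW.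
have xy' : 0 < y - x by rewrite subr_gt0.
have yz' : 0 < z - y by rewrite subr_gt0.
have fyE : f y = f x + e * a * c `^ (a - 1) * (y - x) by rewrite -E; ring.
have fzE : f z = f y + e * a * c' `^ (a - 1) * (z - y) by rewrite -E'; ring.
rewrite -subr_gt0 (_ : _ - _ =
  - (e * a) * (c `^ (a - 1) - c' `^ (a - 1)) * ((y - x) * (z - y))); last first.
  by rewrite fzE fyE; ring.
by rewrite !mulr_gt0 ?subr_gt0// oppr_gt0.
Qed.

End signed_power.

Lemma integrable_powR_cos (a b c : R) : -1 < a -> 0 < c ->
  mu.-integrable `[0, c] (EFin \o (fun t => t `^ a * cos (b * t))).
Proof.
move=> a1 c0.
have mc : measurable_fun [set: R] (fun u : R => cos (b * u)).
  apply: continuous_measurable_fun => x.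
  apply: (continuous_comp (g := @cos R)); last exact: continuous_cos.
  by apply: cvgM; [exact: cvg_cst|exact: cvg_id].
apply: (@integrableMl _ (measurableTypeR R) R mu `[0, c]%classic _
  (EFin \o (fun t => t `^ a)) (fun u => cos (b * u))) => //.
- exact: integrable_powR.
- exact: measurable_funTS.
- by exists 1; split=> [|M M1 x _] /=; [exact: real1|exact: le_trans (cos_max _) (ltW M1)].
Qed.

(** Both regimes of the Hurst index are covered: [e = -1] with an exponent in
    [(0, 1)] and [e = 1] with an exponent in [(-1, 0)].  Substituting
    [t = (T / k) * u] leaves an integral of a convex decreasing function against
    [cos (pi * u)] over [[0, k]]. *)
Lemma powR_fourier_bounds (e a : R) : e ^+ 2 = 1 -> e * a < 0 -> -1 < a -> a < 1 ->
  exists m M : R, [/\ 0 < m, 0 < M &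
  forall (T : R) (k : nat), 0 < T -> (0 < k)%N ->
    let I := e * \int[mu]_(t in `[0, T]) (t `^ a * cos (k%:R * pi * t / T)) in
    [/\ 0 <= I, I <= M * (T / k%:R) `^ (a + 1) &
        ((2 <= k)%N -> m * (T / k%:R) `^ (a + 1) <= I)]].
Proof.
move=> e2 ea aN1 a1; pose f (u : R) := e * u `^ a.
have f_conv := signed_powR_convex ea a1.
have f_decr := signed_powR_decr ea.
have f_int c : 0 < c -> mu.-integrable `[0, c] (EFin \o f).
  move=> c0; apply: (@integrableZl _ (measurableTypeR R) R mu _ _ e
    (EFin \o (fun u => u `^ a))) => //.
  exact: integrable_powR.
pose J (k : R) := \int[mu]_(u in `]0, k]) (f u * cos (pi * u)).
have J2 : 0 < J 2 := Rintegral_cos2_gt0 f_conv f_int.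
have J21 : J 2 <= J 1 := Rintegral_cos_le1 f_conv f_decr f_int (isT : 0 < 2)%N.
exists (J 2), (J 1); split => //; first exact: lt_le_trans J21.
move=> T k T0 k0; have k0' : 0 < k%:R :> R by rewrite ltr0n.
have h0 : 0 < T / k%:R by rewrite divr_gt0.
set I := (X in let I := X in _).
have -> : I = J k%:R * (T / k%:R) `^ (a + 1).
  rewrite /I; set h := T / k%:R.
  have -> : \int[mu]_(t in `[0, T]) (t `^ a * cos (k%:R * pi * t / T)) =
      \int[mu]_(t in `[0, T]) (t `^ a * cos (k%:R * pi / T * t)).
    by apply: eq_Rintegral => t _; rewrite [_ * t / T]mulrAC.
  rewrite (@Rintegral_scale _ h)//; last exact: integrable_powR_cos.
  have -> : T / h = k%:R by rewrite /h invf_div mulrCA mulfV ?gt_eqF// mulr1.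
  have -> : \int[mu]_(u in `[0, k%:R]) ((h * u) `^ a * cos (k%:R * pi / T * (h * u))) =
      \int[mu]_(u in `[0, k%:R]) (h `^ a * (u `^ a * cos (pi * u))).
    apply: eq_Rintegral => u; rewrite inE/= in_itv/= => /andP[u0 _].
    rewrite powRM// ?(ltW h0)// -mulrA; congr (_ * (_ * cos _)).
    have q0 : (k%:R : R) != 0 by rewrite gt_eqF.
    have T0' : T != 0 by rewrite gt_eqF.
    by rewrite /h; move: (k%:R : R) (pi) q0 => q p q0; field; rewrite T0' q0.
  have iJ := integrable_powR_cos pi aN1 k0'.
  rewrite RintegralZl//.
  have -> : J k%:R = e * \int[mu]_(u in `[0, k%:R]) (u `^ a * cos (pi * u)).
    rewrite -Rintegral_itv_obnd_cbnd; last first.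
      by apply: integrableS iJ => //; exact: subset_itv_oc_cc.
    rewrite -RintegralZl//; last first.
      by apply: integrableS iJ => //; exact: subset_itv_oc_cc.
    by apply: eq_Rintegral => u _; rewrite /f mulrA.
  rewrite powRD ?(gt_eqF h0) ?implybT// powRr1 ?(ltW h0)//; ring.
have hpow := powR_gt0 (a + 1) h0.
split.
- apply: mulr_ge0; last exact: ltW.
  have := Rintegral_cos_ge0 f_conv f_decr f_int k 0.
  by rewrite expr0 mul1r add0n.
- by apply: ler_wpM2r; [exact: ltW|exact: Rintegral_cos_le1].
- by move=> k2; apply: ler_wpM2r; [exact: ltW|exact: Rintegral_cos_ge2].
Qed.

End power_coefficients.

Section amplitudes.
Context (R : realType) (T H : R).
Hypotheses (T_gt0 : 0 < T) (H_gt0 : 0 < H) (H_lt1 : H < 1) (H_neq : H != 2^-1).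
Notation mu := (@lebesgue_measure R).

Definition amplitude (k : nat) : R := Num.sqrt (- coef T H k / 2).

Lemma coef_bounds : exists lo hi : R, [/\ 0 < lo, 0 < hi &
  forall k : nat, (0 < k)%N ->
    - coef T H k <= hi * k%:R `^ (- (1 + 2 * H)) /\
    ((2 <= k)%N -> lo * k%:R `^ (- (1 + 2 * H)) <= - coef T H k)].
Proof.
have H0 : 0 < H by []. have H1 : H < 1 by [].
have ratio (a : R) (k : nat) : (0 < k)%N -> (T / k%:R) `^ a = T `^ a * k%:R `^ (- a).
  move=> k0; rewrite powRM ?invr_ge0 ?(ltW T_gt0)//.
  by rewrite -powR_inv1// -powRrM mulN1r.
have Hhalf : (H < 2^-1) || (2^-1 < H) by rewrite -neq_lt.
case/orP: Hhalf => HH.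
- have [||||m [M [m0 M0 bnd]]] := @powR_fourier_bounds R (-1) (2 * H).
  + by rewrite sqrrN expr1n.
  + lra.
  + lra.
  + lra.
  have T2 : 0 < 2 / T * T `^ (2 * H + 1) by rewrite mulr_gt0 ?powR_gt0// divr_gt0.
  exists (2 / T * T `^ (2 * H + 1) * m), (2 / T * T `^ (2 * H + 1) * M).
  split; [exact: mulr_gt0|exact: mulr_gt0|move=> k k0].
  have [_ ub lb] := bnd T k T_gt0 k0.
  have -> : - coef T H k = 2 / T * (-1 * \int[mu]_(t in `[0, T])
      (t `^ (2 * H) * cos (k%:R * pi * t / T))).
    by case: k k0 {ub lb} => // k _; rewrite /coef HH mulrCA mulN1r.
  rewrite !ratio// in ub lb; rewrite (addrC 1).
  have T2' : 0 <= 2 / T by rewrite divr_ge0 ?ltW.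
  split=> [|k2].
  + by apply: le_trans (ler_wpM2l T2' ub) _; rewrite le_eqVlt; apply/orP; left; apply/eqP; ring.
  + by apply: le_trans _ (ler_wpM2l T2' (lb k2)); rewrite le_eqVlt; apply/orP; left; apply/eqP; ring.
- have [||||m [M [m0 M0 bnd]]] := @powR_fourier_bounds R 1 (2 * H - 2).
  + by rewrite expr1n.
  + lra.
  + lra.
  + lra.
  pose K := 4 * H * (2 * H - 1) * T / pi ^+ 2.
  have K0 : 0 < K.
    by rewrite /K !mulr_gt0 ?invr_gt0 ?exprn_gt0 ?pi_gt0//; lra.
  have KT : 0 < K * T `^ (2 * H - 1) by rewrite mulr_gt0 ?powR_gt0.
  exists (K * T `^ (2 * H - 1) * m), (K * T `^ (2 * H - 1) * M).
  split; [exact: mulr_gt0|exact: mulr_gt0|move=> k k0].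
  have [_ ub lb] := bnd T k T_gt0 k0.
  have k0' : 0 < k%:R :> R by rewrite ltr0n.
  have aE : 2 * H - 2 + 1 = 2 * H - 1 by ring.
  have -> : - coef T H k = K * k%:R `^ (- 2) * (1 * \int[mu]_(t in `[0, T])
      (t `^ (2 * H - 2) * cos (k%:R * pi * t / T))).
    rewrite powRN powR_mulrn ?ltW// mul1r.
    case: k k0 {ub lb} k0' => // k _ k0'; rewrite /coef ltNge (ltW HH)/= mulNr opprK.
    by rewrite /K exprMn invfM; ring.
  rewrite !ratio// !aE in ub lb.
  have K2 : 0 <= K * k%:R `^ (- 2) by rewrite mulr_ge0 ?powR_ge0// ltW.
  have kE : k%:R `^ (- (1 + 2 * H)) = k%:R `^ (- 2) * k%:R `^ (- (2 * H - 1)) :> R.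
    rewrite -powRD ?(gt_eqF k0') ?implybT//; congr (_ `^ _); ring.
  rewrite kE; split=> [|k2].
  + by apply: le_trans (ler_wpM2l K2 ub) _; rewrite le_eqVlt; apply/orP; left; apply/eqP; ring.
  + by apply: le_trans _ (ler_wpM2l K2 (lb k2)); rewrite le_eqVlt; apply/orP; left; apply/eqP; ring.
Qed.

Lemma amplitude_bounds : exists s S : R, [/\ 0 < s, 0 < S &
  forall k : nat, (0 < k)%N ->
    amplitude k <= S * k%:R `^ (- (H + 2^-1)) /\
    ((2 <= k)%N -> s * k%:R `^ (- (H + 2^-1)) <= amplitude k)].
Proof.
have [lo [hi [lo0 hi0 bnd]]] := coef_bounds.
exists (Num.sqrt (lo / 2)), (Num.sqrt (hi / 2)); split.
- by rewrite sqrtr_gt0 divr_gt0.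
- by rewrite sqrtr_gt0 divr_gt0.
move=> k k0; have [ub lb] := bnd k k0.
have sq x : 0 <= x -> Num.sqrt (x / 2) * k%:R `^ (- (H + 2^-1)) =
    Num.sqrt (x * k%:R `^ (- (1 + 2 * H)) / 2).
  move=> x0; rewrite [x * _ / 2]mulrAC [RHS]sqrtrM ?divr_ge0//; congr (_ * _).
  rewrite -powR12_sqrt ?powR_ge0// -powRrM; congr (_ `^ _); lra.
rewrite !sq ?(ltW lo0) ?(ltW hi0)//; split=> [|k2]; apply: ler_wsqrtr.
  by rewrite ler_pM2r ?invr_gt0.
by rewrite ler_pM2r ?invr_gt0// lb.
Qed.

End amplitudes.

(** * Increments of the partial sums *)

Section elementary.
Context (R : realType).
Implicit Types x y : R.

Lemma sin_lipschitz x y : `|sin x - sin y| <= `|x - y|.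
Proof.
wlog xy : x y / x <= y.
  move=> h; have [/h//|/ltW/h] := leP x y.
  by rewrite distrC [X in _ <= X -> _]distrC.
have [c _] := @MVT_segment R sin cos x y xy (fun c _ => is_derive_sin c)
  (continuous_subspaceT (@continuous_sin R)).
rewrite distrC => ->; rewrite normrM [leRHS]distrC.
by rewrite ler_piMl// cos_max.
Qed.

Lemma cos_lipschitz x y : `|cos x - cos y| <= `|x - y|.
Proof.
have := sin_lipschitz (x + pi / 2) (y + pi / 2).
by rewrite !sinDpihalf opprD addrACA subrr addr0.
Qed.

(** From [u <= expR u] with [u = l * `|x| - k].  Applied to finitely many [x_i],
    it bounds their maximum by a sum of exponentials, whose mean only involves
    moment generating functions; the best [k] is the logarithm of that mean. *)
Lemma le_expR_exp_moment (l k x : R) : 0 < l ->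
  `|x| <= (k + (expR (l * x) + expR (- l * x)) / expR k) / l.
Proof.
move=> l0; rewrite ler_pdivlMr// mulrC -expRN.
have lx : l * `|x| <= k + expR (l * `|x| - k).
  by have := expR_ge1Dx (l * `|x| - k); lra.
apply: (le_trans lx); rewrite lerD2l expRD ler_pM2r ?expR_gt0//.
have [x0|x0] := leP 0 x; first by rewrite ger0_norm// lerDl expR_ge0.
by rewrite ltr0_norm// mulrN mulNr lerDr expR_ge0.
Qed.

Lemma norm_le_expRD x : `|x| <= expR x + expR (- x).
Proof.
have [x0|x0] := leP 0 x.
  rewrite ger0_norm//; by have := expR_ge1Dx x; have := expR_ge0 (- x); lra.
rewrite ltr0_norm//; by have := expR_ge1Dx (- x); have := expR_ge0 x; lra.
Qed.

Lemma grid_approx (T t : R) (q : nat) : 0 < T -> 0 <= t <= T -> (0 < q)%N ->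
  exists2 i : nat, (i <= q)%N & `|t - i%:R * T / q%:R| <= T / q%:R.
Proof.
move=> T0 /andP[t0 tT] q0; have q0' : 0 < q%:R :> R by rewrite ltr0n.
have u0 : 0 <= t * q%:R / T by rewrite divr_ge0 ?mulr_ge0 ?(ltW T0).
have /andP[le1 lt2] := truncn_itv u0.
exists (Num.truncn (t * q%:R / T)).
  rewrite -(ler_nat R); apply: (le_trans le1).
  by rewrite ler_pdivrMr// [leRHS]mulrC ler_pM2r.
set i := Num.truncn _ in le1 lt2 *.
have e : t = (t * q%:R / T) * (T / q%:R).
  by rewrite mulrA divfK ?gt_eqF// mulfK// gt_eqF.
have Tq : 0 < T / q%:R by rewrite divr_gt0.
have -> : t - i%:R * T / q%:R = (t * q%:R / T - i%:R) * (T / q%:R).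
  by rewrite mulrBl -e mulrA.
rewrite normrM (gtr0_norm Tq).
rewrite ler_piMl ?(ltW Tq)// ger0_norm ?subr_ge0//.
by rewrite lerBlDl (le_trans (ltW lt2))// -natr1 addrC.
Qed.

End elementary.

Section increments.
Context (R : realType) (T H : R) (T_gt0 : 0 < T).
Context d (Omega : measurableType d) (P : probability Omega R).
Variable Z : int -> {RV P >-> R}.

Definition sin_coord (t : R) (k : nat) : R := amplitude T H k * sin (k%:R * pi * t / T).
Definition cos_coord (t : R) (k : nat) : R :=
  amplitude T H k * (1 - cos (k%:R * pi * t / T)).
Definition increment (t : R) (m n : nat) : Omega -> R :=
  gaussian_sum Z (sin_coord t) (cos_coord t) m.+1 n.+1.

Lemma incrementE t m n w : (m <= n)%N ->
  partial_process T H Z n t w - partial_process T H Z m t w = increment t m n w.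
Proof.
move=> mn; pose F (k : nat) := Num.sqrt (- coef T H k / 2) *
  (Z k%:Z w * sin (k%:R * pi * t / T) + Z (- k%:Z) w * (1 - cos (k%:R * pi * t / T))).
transitivity (\sum_(1 <= k < n.+1) F k - \sum_(1 <= k < m.+1) F k).
  by rewrite /partial_process opprD addrACA subrr add0r.
rewrite (@big_cat_nat _ _ _ m.+1)//= [X in X - _]addrC addrK.
by apply: eq_bigr => k _; rewrite /F /sin_coord /cos_coord /amplitude; ring.
Qed.

Lemma increment_cat t m n p w : (m <= n)%N -> (n <= p)%N ->
  increment t m p w = increment t m n w + increment t n p w.
Proof. by move=> mn np; rewrite -!incrementE// ?(leq_trans mn)//; ring. Qed.

Lemma amplitude_ge0 k : 0 <= amplitude T H k.
Proof. exact: sqrtr_ge0. Qed.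

(** The squares of the two trigonometric factors add up to [2 * (1 - cos _)]. *)
Lemma coord_sqr_le t k :
  sin_coord t k ^+ 2 + cos_coord t k ^+ 2 <= 4 * amplitude T H k ^+ 2.
Proof.
rewrite /sin_coord /cos_coord; set x := _ * pi * t / T.
have := cos2Dsin2 x; have := cos_geN1 x; have := sqr_ge0 (amplitude T H k).
by rewrite !exprMn => a0 c1 cs; nra.
Qed.

(** A crude bound, losing a power of the frequency over the true modulus of
    continuity; the mesh of the grid is small enough to absorb the loss. *)
Lemma increment_lipschitz t t' m n w :
  `|increment t m n w - increment t' m n w| <=
  `|t - t'| * \sum_(m.+1 <= k < n.+1)
    (amplitude T H k * (k%:R * pi / T) * (`|Z k%:Z w| + `|Z (- k%:Z) w|)).
Proof.
rewrite /increment /gaussian_sum -sumrB mulr_sumr (le_trans (ler_norm_sum _ _ _))//.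
apply: ler_sum => k _; rewrite /sin_coord /cos_coord.
set a := amplitude T H k; set z1 := Z k%:Z w; set z2 := Z (- k%:Z) w.
set x := k%:R * pi * t / T; set y := k%:R * pi * t' / T.
have a0 : 0 <= a by exact: amplitude_ge0.
have xy : `|x - y| = `|t - t'| * (k%:R * pi / T).
  have -> : x - y = (t - t') * (k%:R * pi / T) by rewrite /x /y; ring.
  by rewrite normrM; congr (_ * _); rewrite ger0_norm// divr_ge0 ?mulr_ge0 ?pi_ge0// ltW.
have -> : a * sin x * z1 + a * (1 - cos x) * z2 - (a * sin y * z1 + a * (1 - cos y) * z2) =
   a * ((sin x - sin y) * z1 + (cos y - cos x) * z2) by ring.
have -> : `|t - t'| * (a * (k%:R * pi / T) * (`|z1| + `|z2|)) =
    a * (`|x - y| * (`|z1| + `|z2|)) by rewrite xy; ring.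
rewrite normrM (ger0_norm a0) ler_wpM2l// mulrDr.
rewrite (le_trans (ler_normD _ _))// !normrM lerD//.
  by rewrite ler_wpM2r// sin_lipschitz.
by rewrite ler_wpM2r// distrC cos_lipschitz.
Qed.

End increments.

(** * A majorant for the increments in a dyadic block *)

Section expectation_bounds.
Context d (Omega : measurableType d) (R : realType) (P : probability Omega R).

Lemma integral_sum_le (I : eqType) (s : seq I) (F : I -> Omega -> R) (c : I -> R) :
  (forall i, measurable_fun [set: Omega] (F i)) -> (forall i w, 0 <= F i w) ->
  (forall i, i \in s -> (\int[P]_w (F i w)%:E <= (c i)%:E)%E) ->
  (\int[P]_w (\sum_(i <- s) F i w)%:E <= (\sum_(i <- s) c i)%:E)%E.
Proof.
move=> mF F0 Fc; under eq_integral do rewrite -sumEFin.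
rewrite ge0_integral_sum//; last 2 first.
  by move=> i; exact/measurable_EFinP.
  by move=> i w _; rewrite lee_fin.
by rewrite -sumEFin big_seq [leRHS]big_seq; apply: lee_sum => i; exact: Fc.
Qed.

Lemma integral_affine_le (a b c : R) (F : Omega -> R) : 0 <= a -> 0 <= b ->
  measurable_fun [set: Omega] F -> (forall w, 0 <= F w) ->
  (\int[P]_w (F w)%:E <= c%:E)%E ->
  (\int[P]_w (a + b * F w)%:E <= (a + b * c)%:E)%E.
Proof.
move=> a0 b0 mF F0 Fc; under eq_integral do rewrite EFinD EFinM.
rewrite ge0_integralD//; last 2 first.
- by move=> w _; rewrite mule_ge0// lee_fin.
- by apply: measurable_funeM; exact/measurable_EFinP.
rewrite integral_cst//= probability_setT mule1 ge0_integralZl//; last 2 first.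
- exact/measurable_EFinP.
- by move=> w _; rewrite lee_fin.
by rewrite EFinD EFinM leeD2l// lee_wpmul2l// lee_fin.
Qed.

End expectation_bounds.

Section blocks.
Context (R : realType) (T H S : R).
Hypotheses (T_gt0 : 0 < T) (H_gt0 : 0 < H) (S_gt0 : 0 < S).
Hypothesis amp_le : forall k, (0 < k)%N -> amplitude T H k <= S * k%:R `^ (- (H + 2^-1)).
Context d (Omega : measurableType d) (P : probability Omega R).
Variable Z : int -> {RV P >-> R}.

Definition block_rate (j : nat) : R := (2 ^ j)%:R `^ H.
(** Exponential parameter [l] used in [le_expR_exp_moment]. *)
Definition block_tilt (j : nat) : R := Num.sqrt j.+1%:R * block_rate j.
(** Logarithm of a bound on the mean of [block_exp]: the number of terms is at
    most [8 ^ j.+1], below [expR (3 * j.+1)], and the rest accounts for the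
    Gaussian moments. *)
Definition block_log (j : nat) : R := (3 + 2 * S ^+ 2) * j.+1%:R.
(** With spacing [T / 4 ^ j] the mean Lipschitz error is at most of order
    [2 ^ (- j H)], like the standard deviation of the increments. *)
Definition block_point (j i : nat) : R := i%:R * T / ((2 ^ j) ^ 2)%N%:R.

Definition block_exp (j : nat) (w : Omega) : R :=
  \sum_(0 <= n < (2 ^ j).+1) \sum_(0 <= i < ((2 ^ j) ^ 2).+1)
    (expR (block_tilt j * increment T H Z (block_point j i) (2 ^ j) (2 ^ j + n) w) +
     expR (- block_tilt j * increment T H Z (block_point j i) (2 ^ j) (2 ^ j + n) w)).

Definition block_slope (j : nat) (w : Omega) : R :=
  \sum_((2 ^ j).+1 <= k < (2 ^ j.+1).+1)
    ((expR (Z k%:Z w) + expR (- Z k%:Z w)) +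
     (expR (Z (- k%:Z) w) + expR (- Z (- k%:Z) w))).

Definition block_bound (j : nat) (w : Omega) : R :=
  (block_log j + block_exp j w / expR (block_log j)) / block_tilt j +
  2 * pi * S / ((2 ^ j)%:R * block_rate j) * block_slope j w.

Let M0 j : 0 < (2 ^ j)%N%:R :> R.
Proof. by rewrite ltr0n expn_gt0. Qed.

Lemma block_rate_gt0 j : 0 < block_rate j.
Proof. exact: powR_gt0. Qed.

Lemma block_tilt_gt0 j : 0 < block_tilt j.
Proof. by rewrite mulr_gt0 ?block_rate_gt0// sqrtr_gt0 ltr0n. Qed.

Lemma amplitude_block_le j k : (2 ^ j <= k)%N ->
  amplitude T H k <= S * (2 ^ j)%:R `^ (- (H + 2^-1)).
Proof.
move=> jk; have k0 : (0 < k)%N by rewrite (leq_trans _ jk)// expn_gt0.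
apply: (le_trans (amp_le k0)); rewrite ler_pM2l// !powRN lef_pV2 ?posrE ?powR_gt0//.
  have H0 : 0 <= H + 2^-1 by rewrite addr_ge0// ltW.
  by apply: (ge0_ler_powR H0); rewrite ?nnegrE ?ler_nat.
by rewrite ltr0n.
Qed.

(** Move [t] to the nearest grid point on its left.  The increment there is one
    of the terms of [block_exp], and the displacement is at most the mesh times
    the Lipschitz constant. *)
Lemma block_boundP j n t w : 0 <= t <= T -> (2 ^ j <= n <= 2 ^ j.+1)%N ->
  `|increment T H Z t (2 ^ j) n w| <= block_bound j w.
Proof.
move=> t0T /andP[jn nj].
have q0 : (0 < (2 ^ j) ^ 2)%N by rewrite !expn_gt0.
have [i iq it] := grid_approx T_gt0 t0T q0.
rewrite -(subrK (increment T H Z (block_point j i) (2 ^ j) n w)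
  (increment T H Z t (2 ^ j) n w)) (le_trans (ler_normD _ _))// addrC.
apply: lerD.
  have tilt0 := block_tilt_gt0 j.
  apply: (le_trans (le_expR_exp_moment (block_log j) _ tilt0)).
  rewrite ler_pM2r ?invr_gt0// lerD2l ler_pM2r ?invr_gt0 ?expR_gt0//.
  have nE : n = (2 ^ j + (n - 2 ^ j))%N by rewrite subnKC.
  have nj' : (n - 2 ^ j < (2 ^ j).+1)%N by move: nj; rewrite expnS; lia.
  pose G (n i : nat) :=
    expR (block_tilt j * increment T H Z (block_point j i) (2 ^ j) (2 ^ j + n) w) +
    expR (- block_tilt j * increment T H Z (block_point j i) (2 ^ j) (2 ^ j + n) w).
  have G0 n' i' : 0 <= G n' i' by rewrite addr_ge0 ?expR_ge0.
  apply: (@le_trans _ _ (G (n - 2 ^ j)%N i)); first by rewrite /G -nE.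
  rewrite /block_exp !big_mkord (bigD1 (Ordinal nj'))//= -[leLHS]addr0 lerD//.
    have iq' : (i < ((2 ^ j) ^ 2).+1)%N by rewrite ltnS.
    rewrite big_mkord (bigD1 (Ordinal iq'))//= -[leLHS]addr0 lerD//.
    by apply: sumr_ge0 => ? _; exact: G0.
  by apply: sumr_ge0 => ? _; apply: sumr_ge0 => ? _; exact: G0.
apply: (le_trans (increment_lipschitz H T_gt0 _ _ _ _ _ _)).
rewrite /block_slope.
apply: (@le_trans _ _ (\sum_((2 ^ j).+1 <= k < (2 ^ j.+1).+1)
   `|t - block_point j i| * (amplitude T H k * (k%:R * pi / T) *
      (`|Z k%:Z w| + `|Z (- k%:Z) w|)))).
  rewrite -mulr_sumr ler_wpM2l// [leRHS](@big_cat_nat _ _ _ n.+1)//=.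
  rewrite lerDl sumr_ge0// => k _.
  by rewrite !mulr_ge0 ?amplitude_ge0 ?invr_ge0 ?pi_ge0 ?addr_ge0// ltW.
rewrite mulr_sumr; apply: ler_sum_nat => k /andP[jk kj].
rewrite [leLHS]mulrA; apply: ler_pM.
- by rewrite !mulr_ge0 ?amplitude_ge0 ?invr_ge0 ?pi_ge0// ltW.
- by rewrite addr_ge0.
- have a_le := amplitude_block_le (ltnW jk).
  have a0 := amplitude_ge0 T H k.
  have k_le : k%:R <= 2 * (2 ^ j)%:R :> R by rewrite -natrM ler_nat -expnS.
  have kT : k%:R * pi / T <= 2 * (2 ^ j)%:R * pi / T.
    by rewrite ler_pM2r ?invr_gt0// ler_pM2r ?pi_gt0.
  have kT0 : 0 <= k%:R * pi / T by rewrite divr_ge0 ?mulr_ge0 ?pi_ge0// ltW.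
  apply: (le_trans (ler_pM _ _ it (ler_pM a0 kT0 a_le kT))) => //.
    by rewrite mulr_ge0.
  have -> : T / ((2 ^ j) ^ 2)%:R * (S * (2 ^ j)%:R `^ (- (H + 2^-1)) *
      (2 * (2 ^ j)%:R * pi / T)) =
      2 * pi * S / (2 ^ j)%:R * (2 ^ j)%:R `^ (- (H + 2^-1)).
    have := M0 j; rewrite (natrX R (2 ^ j)%N 2).
    move: (_ `^ _) => x; move: (pi) => p; move: ((2 ^ j)%N%:R) => M M_gt0; field.
    by rewrite !gt_eqF.
  rewrite invfM mulrA ler_wpM2l ?divr_ge0 ?mulr_ge0 ?pi_ge0// ?(ltW S_gt0)//.
  rewrite /block_rate -powRN ler_powR ?ler1n ?expn_gt0// lerN2 lerDl.
  by rewrite invr_ge0.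
- by apply: lerD; exact: norm_le_expRD.
Qed.

End blocks.

Section block_expectation.
Context (R : realType) (T H S : R).
Hypotheses (T_gt0 : 0 < T) (H_gt0 : 0 < H) (S_gt0 : 0 < S).
Hypothesis amp_le : forall k, (0 < k)%N -> amplitude T H k <= S * k%:R `^ (- (H + 2^-1)).
Context d (Omega : measurableType d) (P : probability Omega R).
Variable Z : int -> {RV P >-> R}.

Let M0 j : 0 < (2 ^ j)%N%:R :> R.
Proof. by rewrite ltr0n expn_gt0. Qed.

(** At most [2 ^ j] terms, each at most [S ^+ 2 * (2 ^ j) `^ (- (2 * H + 1))]. *)
Lemma sum_amplitude_block j n : (n <= 2 ^ j)%N ->
  \sum_((2 ^ j).+1 <= k < (2 ^ j + n).+1) amplitude T H k ^+ 2 <= S ^+ 2 / block_rate H j ^+ 2.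
Proof.
move=> nj; apply: (@le_trans _ _ (\sum_((2 ^ j).+1 <= k < (2 ^ j + n).+1)
    (S * (2 ^ j)%:R `^ (- (H + 2^-1))) ^+ 2)).
  apply: ler_sum_nat => k /andP[jk _]; rewrite ler_sqr ?nnegrE ?amplitude_ge0//.
    exact: amplitude_block_le (ltnW jk).
  by rewrite mulr_ge0 ?powR_ge0// ltW.
rewrite sumr_const_nat subSS addKn -[leLHS]mulr_natr exprMn -[leLHS]mulrA ler_wpM2l ?sqr_ge0//.
apply: (@le_trans _ _ (((2 ^ j)%:R `^ (- (H + 2^-1))) ^+ 2 * (2 ^ j)%:R)).
  by rewrite ler_wpM2l ?sqr_ge0// ler_nat.
rewrite -exprVn /block_rate -powRN -!powR_mulrn ?powR_ge0// -!powRrM.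
rewrite -[X in _ * X](@powRr1 _ (2 ^ j)%:R) ?ler0n//.
rewrite -powRD; last by rewrite (gt_eqF (M0 j)) implybT.
rewrite le_eqVlt; apply/orP; left; apply/eqP; congr (_ `^ _).
by lra.
Qed.

Hypothesis indepZ : mutually_independent Z.
Hypothesis gaussZ : forall k, standard_gaussian (Z k).

Lemma measurable_increment t m n : measurable_fun [set: Omega] (increment T H Z t m n).
Proof. exact: measurable_gaussian_sum. Qed.

Lemma increment_exp_moment (t c V : R) m n :
  \sum_(m.+1 <= k < n.+1) amplitude T H k ^+ 2 <= V ->
  (\int[P]_w (expR (c * increment T H Z t m n w))%:E <= (expR (2 * c ^+ 2 * V))%:E)%E.
Proof.
move=> sV; under eq_integral do rewrite -gaussian_sumZ.
rewrite (integral_expR_gaussian_sum indepZ gaussZ)// lee_fin ler_expR.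
apply: (@le_trans _ _ (2 * c ^+ 2 * \sum_(m.+1 <= k < n.+1) amplitude T H k ^+ 2)).
  rewrite mulr_sumr; apply: ler_sum => k _.
  have := coord_sqr_le T H t k; have := sqr_ge0 c; rewrite !exprMn; nra.
by rewrite ler_wpM2l// mulr_ge0// sqr_ge0.
Qed.

Lemma measurable_block_exp j : measurable_fun [set: Omega] (block_exp T H Z j).
Proof.
apply: measurable_sum => n; apply: measurable_sum => i; apply: measurable_funD;
  by apply: measurableT_comp => //; apply: measurable_funM => //; exact: measurable_increment.
Qed.

Lemma measurable_block_slope j : measurable_fun [set: Omega] (block_slope Z j).
Proof.
apply: measurable_sum => k; apply: measurable_funD; apply: measurable_funD;
  do ?[exact: measurableT_comp]; apply: measurableT_comp => //; exact: measurableT_comp.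
Qed.

Lemma block_exp_ge0 j w : 0 <= block_exp T H Z j w.
Proof. by do 2 (apply: sumr_ge0 => ? _); rewrite addr_ge0 ?expR_ge0. Qed.

Lemma block_slope_ge0 j w : 0 <= block_slope Z j w.
Proof. by apply: sumr_ge0 => ? _; rewrite !addr_ge0 ?expR_ge0. Qed.

Lemma block_log_ge0 j : 0 <= block_log S j.
Proof. by rewrite mulr_ge0// addr_ge0// mulr_ge0// sqr_ge0. Qed.

Lemma block_bound_ge0 j w : 0 <= block_bound T H S Z j w.
Proof.
rewrite addr_ge0// ?mulr_ge0 ?invr_ge0 ?mulr_ge0 ?pi_ge0 ?(ltW (block_rate_gt0 _ _)) ?block_slope_ge0 ?(ltW S_gt0)//.
  by rewrite addr_ge0 ?block_log_ge0// mulr_ge0 ?block_exp_ge0// invr_ge0 expR_ge0.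
Qed.

Lemma measurable_block_bound j : measurable_fun [set: Omega] (block_bound T H S Z j).
Proof.
apply: measurable_funD.
  apply: measurable_funM => //; apply: measurable_funD => //.
  by apply: measurable_funM => //; exact: measurable_block_exp.
by apply: measurable_funM => //; exact: measurable_block_slope.
Qed.

(** The tilt is chosen so that [block_tilt j ^+ 2] times the variance of an
    increment is of order [j.+1], the order of the logarithm of the number of
    terms. *)
Lemma integral_block_exp j :
  (\int[P]_w (block_exp T H Z j w)%:E <= (expR (block_log S j))%:E)%E.
Proof.
have rate0 := block_rate_gt0 H j.
pose E := expR (2 * S ^+ 2 * j.+1%:R).
apply: (@le_trans _ _ (\sum_(0 <= n < (2 ^ j).+1) \sum_(0 <= i < ((2 ^ j) ^ 2).+1) (E + E))%:E).
  apply: integral_sum_le => [n|n w|n].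
  - apply: measurable_sum => i; apply: measurable_funD;
    by apply: measurableT_comp => //; apply: measurable_funM => //; exact: measurable_increment.
  - by apply: sumr_ge0 => ? _; rewrite addr_ge0 ?expR_ge0.
  rewrite mem_index_iota => /andP[_ nj].
  apply: integral_sum_le => [i|i w|i _].
  - apply: measurable_funD;
    by apply: measurableT_comp => //; apply: measurable_funM => //; exact: measurable_increment.
  - by rewrite addr_ge0 ?expR_ge0.
  have mE (c : R) : measurable_fun [set: Omega] (fun w =>
      (expR (c * increment T H Z (block_point T j i) (2 ^ j) (2 ^ j + n) w))%:E).
    by apply/measurable_EFinP; apply: measurableT_comp => //; apply: measurable_funM => //;
      exact: measurable_increment.
  under eq_integral do rewrite EFinD.
  rewrite ge0_integralD//.
  have EE (c : R) : c ^+ 2 = block_tilt H j ^+ 2 -> expR (2 * c ^+ 2 * (S ^+ 2 / block_rate H j ^+ 2)) = E.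
    move=> ->; congr expR; rewrite /block_tilt exprMn sqr_sqrtr//.
    by move: (block_rate H j) rate0 => r r0; field; rewrite gt_eqF.
  have sV := sum_amplitude_block nj.
  have E1 := EE _ (erefl (block_tilt H j ^+ 2)).
  have E2 := EE _ (sqrrN (block_tilt H j)).
  rewrite EFinD; apply: leeD.
    by apply: (le_trans (increment_exp_moment _ _ sV)); rewrite E1.
  by apply: (le_trans (increment_exp_moment _ _ sV)); rewrite E2.
rewrite lee_fin !sumr_const_nat !subn0 -mulrnA -[X in X *+ _](mulr2n E) -mulrnA -mulr_natl.
rewrite /block_log mulrDl expRD ler_pM2r ?expR_gt0//.
have e2 : 2 <= expR 1 :> R by have := expR_ge1Dx (1 : R); lra.
apply: (@le_trans _ _ ((2 ^ (3 * j.+1))%N%:R)).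
  rewrite ler_nat expnM (_ : 2 ^ 3 = 8)%N//.
  rewrite (_ : 8 ^ j.+1 = 8 * (2 ^ j * 2 ^ j * 2 ^ j))%N; last first.
    by rewrite expnS -!expnMn.
  have : (0 < 2 ^ j)%N by rewrite expn_gt0.
  by move: (2 ^ j)%N => M M_gt0; nia.
rewrite natrX -[3 * _]mulr1 -natrM expRM_natl.
by apply: lerXn2r => //; rewrite nnegrE// expR_ge0.
Qed.

Definition block_const : R := 4 + 2 * S ^+ 2 + 8 * pi * S * expR 2^-1.

(** The normalisation by [expR (block_log j)] makes the exponential part at most
    [(block_log j + 1) / block_tilt j] in the mean, of order
    [sqrt (j + 1) / block_rate j]; the Lipschitz part has order
    [1 / block_rate j]. *)
Lemma integral_block_bound j :
  (\int[P]_w (block_bound T H S Z j w)%:E <=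
   (block_const * (Num.sqrt j.+1%:R / block_rate H j))%:E)%E.
Proof.
have rate0 := block_rate_gt0 H j; have tilt0 := block_tilt_gt0 H j.
have jS : 1 <= j.+1%:R :> R by rewrite ler1n.
have sq1 : 1 <= Num.sqrt j.+1%:R :> R by rewrite -[leLHS]sqrtr1 ler_wsqrtr.
have sqj : Num.sqrt j.+1%:R ^+ 2 = j.+1%:R :> R by rewrite sqr_sqrtr.
pose cs := 2 * pi * S / ((2 ^ j)%N%:R * block_rate H j).
have cs0 : 0 <= cs.
  by rewrite /cs divr_ge0 ?mulr_ge0 ?pi_ge0 ?(ltW rate0) ?(ltW S_gt0).
have exp_le : (\int[P]_w ((block_log S j + block_exp T H Z j w / expR (block_log S j)) /
    block_tilt H j)%:E <= ((block_log S j + 1) / block_tilt H j)%:E)%E.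
  under eq_integral => w _ do rewrite mulrDl -mulrA [_ * (_ / _)]mulrC.
  apply: (le_trans (integral_affine_le _ _ _ _ (integral_block_exp j))).
  - by rewrite divr_ge0 ?block_log_ge0 ?(ltW tilt0).
  - by rewrite divr_ge0 ?invr_ge0 ?expR_ge0 ?(ltW tilt0).
  - exact: measurable_block_exp.
  - exact: block_exp_ge0.
  by rewrite lee_fin [_ / _ * _]mulrAC mulVf ?gt_eqF ?expR_gt0// mulrDl.
have slope_le : (\int[P]_w (block_slope Z j w)%:E <= (4 * expR 2^-1 * (2 ^ j)%N%:R)%:E)%E.
  have -> : 4 * expR 2^-1 * (2 ^ j)%N%:R =
      \sum_((2 ^ j).+1 <= k < (2 ^ j.+1).+1) ((expR 2^-1 + expR 2^-1) + (expR 2^-1 + expR 2^-1)) :> R.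
    rewrite sumr_const_nat subSS expnS mul2n -addnn addnK -mulr_natr; ring.
  have mexp (c : R) k : measurable_fun [set: Omega] (fun w => expR (c * Z k w)).
    by apply: measurableT_comp => //; exact: measurable_funM.
  have mom (c : R) k : c ^+ 2 = 1 -> (\int[P]_w (expR (c * Z k w))%:E <= (expR 2^-1)%:E)%E.
    by move=> c1; rewrite (integral_expR_gaussian gaussZ) c1 mul1r.
  have mom2 k : (\int[P]_w (expR (Z k w) + expR (- Z k w))%:E <=
      (expR 2^-1 + expR 2^-1)%:E)%E.
    under eq_integral => w _ do rewrite -[in X in _ + X]mulN1r -[in X in X + _](mul1r (Z k w)) EFinD.
    rewrite ge0_integralD//; try exact/measurable_EFinP/mexp.
    by rewrite EFinD; apply: leeD; apply: mom; rewrite ?sqrrN expr1n.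
  have mE2 k : measurable_fun [set: Omega] (fun w => expR (Z k w) + expR (- Z k w)).
    by apply: measurable_funD; apply: measurableT_comp => //; exact: measurableT_comp.
  apply: integral_sum_le => [k|k w|k _].
  - exact: measurable_funD.
  - by rewrite !addr_ge0 ?expR_ge0.
  under eq_integral do rewrite EFinD.
  rewrite ge0_integralD//; try exact/measurable_EFinP.
  - by rewrite [leRHS]EFinD; apply: leeD.
have mslope := measurable_block_slope j.
have cslope_le : (\int[P]_w (cs * block_slope Z j w)%:E <=
    (cs * (4 * expR 2^-1 * (2 ^ j)%N%:R))%:E)%E.
  under eq_integral do rewrite -[_ * _]add0r.
  rewrite -[(cs * _)%R]add0r; apply: integral_affine_le => // w.
  exact: block_slope_ge0.
under eq_integral do rewrite EFinD.
rewrite ge0_integralD//; last 4 first.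
- move=> w _; rewrite lee_fin divr_ge0 ?(ltW tilt0)// addr_ge0 ?block_log_ge0//.
  by rewrite divr_ge0 ?block_exp_ge0 ?expR_ge0.
- apply/measurable_EFinP; apply: measurable_funM => //; apply: measurable_funD => //.
  by apply: measurable_funM => //; exact: measurable_block_exp.
- by move=> w _; rewrite lee_fin mulr_ge0 ?block_slope_ge0.
- by apply/measurable_EFinP; apply: measurable_funM.
apply: (le_trans (leeD exp_le cslope_le)).
have logE : block_log S j = (3 + 2 * S ^+ 2) * Num.sqrt j.+1%:R ^+ 2.
  by rewrite sqj.
rewrite -EFinD lee_fin logE /block_tilt /cs /block_const.
move: (block_rate H j) (Num.sqrt _) ((2 ^ j)%N%:R : R) rate0 sq1 (M0 j) => r q M r0 q1 M_gt0.
have q0 : 0 < q by lra.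
move: (expR _) (expR_gt0 (2^-1 : R)) (pi) (pi_gt0 R) => e e0 p p0.
have -> : 2 * p * S / (M * r) * (4 * e * M) = 8 * p * S * e / r.
  by field; rewrite !gt_eqF.
rewrite [leRHS]mulrDl; apply: lerD.
  rewrite ler_pdivrMr ?mulr_gt0//.
  have -> : (4 + 2 * S ^+ 2) * (q / r) * (q * r) = (4 + 2 * S ^+ 2) * q ^+ 2.
    by field; rewrite gt_eqF.
  by have := sqr_ge0 S; nra.
by rewrite mulrA ler_pM2r ?invr_gt0// ler_peMr// !mulr_ge0 ?ltW.
Qed.

End block_expectation.

(** * Uniform convergence and the pathwise error bound *)

Section pathwise.
Context (R : realType) (T H S : R).
Hypotheses (T_gt0 : 0 < T) (H_gt0 : 0 < H) (S_gt0 : 0 < S).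
Hypothesis amp_le : forall k, (0 < k)%N -> amplitude T H k <= S * k%:R `^ (- (H + 2^-1)).
Context d (Omega : measurableType d) (P : probability Omega R).
Variable Z : int -> {RV P >-> R}.

Local Notation W := (block_bound T H S Z).

Definition tail_bound (m : nat) (w : Omega) : \bar R :=
  (\sum_(m <= j <oo) (W j w)%:E)%E.

Lemma tail_bound_ge0 m w : (0 <= tail_bound m w)%E.
Proof. by apply: nneseries_ge0 => n _ _; rewrite lee_fin block_bound_ge0. Qed.

Lemma tail_bound_split m n w : (m <= n)%N ->
  tail_bound m w = ((\sum_(m <= j < n) W j w)%:E + tail_bound n w)%E.
Proof.
move=> mn; rewrite /tail_bound (nneseries_split m (n - m)); last first.
  by move=> k _; rewrite lee_fin block_bound_ge0.
by rewrite subnKC// sumEFin.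
Qed.

Lemma tail_bound_lty m w : (tail_bound m w < +oo)%E -> (tail_bound 0 w < +oo)%E.
Proof. by move=> V; rewrite (tail_bound_split w (leq0n m)) lte_add_pinfty// ltry. Qed.

Lemma le_tail_bound m n w : (m <= n)%N -> (tail_bound n w <= tail_bound m w)%E.
Proof.
move=> mn; rewrite (tail_bound_split w mn) leeDr// lee_fin.
by apply: sumr_ge0 => j _; exact: block_bound_ge0.
Qed.

(** Chain through the powers of two between [2 ^ m] and [n]. *)
Lemma increment_tail m n t w : 0 <= t <= T -> (2 ^ m <= n)%N ->
  (`|increment T H Z t (2 ^ m) n w|%:E <= tail_bound m w)%E.
Proof.
move=> t0T mn.
have block J k : (m <= J)%N -> (2 ^ J <= k <= 2 ^ J.+1)%N ->
    `|increment T H Z t (2 ^ m) k w| <= \sum_(m <= j < J.+1) W j w.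
  elim: J k => [|J IH] k mJ kJ.
    move: mJ kJ; rewrite leqn0 => /eqP -> kJ.
    by rewrite big_nat1; exact: block_boundP.
  move: mJ; rewrite leq_eqVlt => /predU1P[mJ|mJ].
    by rewrite -mJ big_nat1; apply: block_boundP => //; rewrite mJ.
  rewrite (@increment_cat _ _ _ _ _ _ _ _ _ (2 ^ J.+1)); last 2 first.
  - by rewrite leq_pexp2l// ltnW.
  - by case/andP: kJ.
  rewrite (le_trans (ler_normD _ _))// big_nat_recr//=; last exact: ltnW.
  apply: lerD; last exact: block_boundP.
  by apply: IH => //; rewrite leqnn leq_pexp2l.
have n0 : (0 < n)%N by rewrite (leq_trans _ mn)// expn_gt0.
have /andP[J1 J2] := trunc_log_bounds (isT : 1 < 2)%N n0.
set J := trunc_log 2 n in J1 J2.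
have mJ : (m <= J)%N by exact: trunc_log_max.
rewrite (tail_bound_split w (leqW mJ)) (@le_trans _ _ (\sum_(m <= j < J.+1) W j w)%:E)//.
  by rewrite lee_fin block// J1 ltnW.
by rewrite leeDl// tail_bound_ge0.
Qed.

(** Both [B^n] and [B^N] are compared with [B^(2 ^ m)], whence the factor 2. *)
Lemma partial_dist_tail m N n t w : 0 <= t <= T -> (2 ^ m <= N <= 2 ^ m.+1)%N -> (N <= n)%N ->
  (`|partial_process T H Z n t w - partial_process T H Z N t w|%:E <=
   2%:E * tail_bound m w)%E.
Proof.
move=> t0T /andP[mN Nm] Nn; rewrite incrementE//.
have -> : increment T H Z t N n w =
    increment T H Z t (2 ^ m) n w - increment T H Z t (2 ^ m) N w.
  by rewrite (@increment_cat _ _ _ _ _ _ _ _ (2 ^ m) N n)// [RHS]addrAC subrr add0r.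
rewrite (@le_trans _ _ (`|increment T H Z t (2 ^ m) n w|%:E +
    `|increment T H Z t (2 ^ m) N w|%:E)%E)//.
  by rewrite -EFinD lee_fin ler_normB.
rewrite (_ : 2%:E = 1%:E + 1%:E)%E; last by rewrite -EFinD.
rewrite ge0_muleDl ?lee_fin// !mul1e.
by apply: leeD; apply: increment_tail => //; exact: leq_trans Nn.
Qed.

Lemma tail_bound_cvg0 w : (tail_bound 0 w < +oo)%E ->
  (tail_bound m w @[m --> \oo] --> 0)%E.
Proof.
move=> V; apply: nneseries_tail_cvg => // k _.
by rewrite lee_fin block_bound_ge0.
Qed.

Lemma tail_bound_lt w e : 0 < e -> (tail_bound 0 w < +oo)%E ->
  exists m, (tail_bound m w < e%:E)%E.
Proof.
move=> e0 /tail_bound_cvg0 V0.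
have [m _ h] : \forall m \near \oo, (tail_bound m w < e%:E)%E.
  have /V0 : nbhs 0%E (fun x : \bar R => (x < e%:E)%E).
    by apply: open_ereal_lt'; rewrite lte_fin.
  by [].
by exists m; exact: h (leqnn m).
Qed.

Lemma partial_process_cvg t w : 0 <= t <= T -> (tail_bound 0 w < +oo)%E ->
  partial_process T H Z N t w @[N --> \oo] --> limit_process T H Z t w.
Proof.
move=> t0T V.
suff : cvgn (fun N => partial_process T H Z N t w) by [].
apply/cauchy_cvgP; apply: cauchy_exP => e e0.
have [m Ve] := tail_bound_lt e0 V.
exists (partial_process T H Z (2 ^ m) t w), (2 ^ m)%N => // n /= mn.
rewrite /ball/= distrC incrementE// -lte_fin.
by apply: le_lt_trans Ve; exact: increment_tail.
Qed.

Lemma limit_dist_tail m N t w : 0 <= t <= T -> (2 ^ m <= N <= 2 ^ m.+1)%N ->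
  (tail_bound 0 w < +oo)%E ->
  (`|limit_process T H Z t w - partial_process T H Z N t w|%:E <=
   2%:E * tail_bound m w)%E.
Proof.
move=> t0T mN V.
have Vm : tail_bound m w \is a fin_num.
  rewrite ge0_fin_numE ?tail_bound_ge0//.
  exact: le_lt_trans (le_tail_bound w (leq0n m)) V.
rewrite -(fineK Vm) -EFinM lee_fin.
have uc : `|partial_process T H Z n t w - partial_process T H Z N t w| @[n --> \oo] -->
    `|limit_process T H Z t w - partial_process T H Z N t w|.
  by apply: cvg_norm; apply: cvgB; [exact: partial_process_cvg|exact: cvg_cst].
rewrite -(cvg_lim _ uc)//; apply: limr_le; first by apply/cvg_ex; eexists; exact: uc.
exists N => // n /= Nn; rewrite -lee_fin EFinM fineK//.
exact: partial_dist_tail.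
Qed.

(** Where the tail is infinite the bound is trivial, so it holds for every
    [w], including those for which the limit process is a default value. *)
Lemma sup_error_le m N w : (2 ^ m <= N <= 2 ^ m.+1)%N ->
  (sup_error T H Z N w <= 2%:E * tail_bound m w)%E.
Proof.
move=> mN.
have [V|] := ltP (tail_bound m w) +oo%E; last first.
  by rewrite leye_eq => /eqP ->; rewrite gt0_muley ?leey// lte_fin.
apply: ge_ereal_sup => _ [t /= t0T <-].
apply: limit_dist_tail => //; last exact: tail_bound_lty V.
Qed.

Lemma partial_process_uniform_cvg w : (tail_bound 0 w < +oo)%E ->
  {uniform `[0, T], (fun N t => partial_process T H Z N t w) @ \oo -->
                    (fun t => limit_process T H Z t w)}.
Proof.
move=> V Q /uniform_nbhs[E [entE EQ]].
move: entE; rewrite -entourage_ballE => -[e /= e0 eE].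
have [m Ve] := tail_bound_lt (divr_gt0 e0 (ltr0Sn R 1)) V.
exists (2 ^ m)%N => // N /= mN; apply: EQ => t /=; rewrite in_itv/= => t0T.
apply: eE => /=; rewrite /ball/=.
have N0 : (0 < N)%N by rewrite (leq_trans _ mN)// expn_gt0.
have /andP[J1 J2] := trunc_log_bounds (isT : 1 < 2)%N N0.
rewrite -lte_fin.
apply: (le_lt_trans (limit_dist_tail t0T (m := trunc_log 2 N) _ V)).
  by rewrite J1 ltnW.
have mJ : (m <= trunc_log 2 N)%N by exact: trunc_log_max.
apply: (@le_lt_trans _ _ (2%:E * tail_bound m w)%E).
  by rewrite lee_wpmul2l// ?lee_fin// le_tail_bound.
by rewrite muleC -lte_pdivlMr// mulrC.
Qed.

End pathwise.

(** * The upper bound in expectation *)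

(** [\int] of a nonnegative function is a supremum over simple functions below
    it, hence monotone even without measurability. *)
Lemma ge0_le_integral_nonmeasurable d (Omega : measurableType d) (R : realType)
    (mu : {measure set Omega -> \bar R}) (f g : Omega -> \bar R) :
  (forall x, 0 <= f x)%E -> (forall x, f x <= g x)%E ->
  (\int[mu]_x f x <= \int[mu]_x g x)%E.
Proof.
move=> f0 fg; have g0 x : (0 <= g x)%E by exact: le_trans (fg x).
rewrite !ge0_integralTE//; apply: ge_ereal_sup => _ [h hf <-].
by apply: ereal_sup_ubound; exists h => // x; exact: le_trans (fg x).
Qed.

(** Multiplying the sum by [(1 - q) ^+ 2] gives
    [1 - n.+1%:R * q ^+ n + n%:R * q ^+ n.+1]. *)
Lemma sum_arith_geometric_le (R : realType) (q : R) n : 0 < q -> q < 1 ->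
  \sum_(0 <= i < n) i.+1%:R * q ^+ i <= ((1 - q) ^+ 2)^-1.
Proof.
move=> q0 q1; have q1' : 0 < 1 - q by rewrite subr_gt0.
have closed : (1 - q) ^+ 2 * \sum_(0 <= i < n) i.+1%:R * q ^+ i =
    1 - n.+1%:R * q ^+ n + n%:R * q ^+ n.+1.
  elim: n => [|n IH]; first by rewrite big_nil expr0 !mul0r mulr0; ring.
  by rewrite big_nat_recr//= mulrDr IH -!natr1 !exprS; ring.
rewrite -[leRHS]mul1r ler_pdivlMr ?exprn_gt0// mulrC closed.
rewrite -addrA gerDl addrC subr_le0 exprS.
have qn : 0 < q ^+ n by exact: exprn_gt0.
rewrite mulrA ler_pM2r// -natr1.
by have : 0 <= n%:R :> R by []; nra.
Qed.

Section expected_tail.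
Context (R : realType) (T H S : R).
Hypotheses (T_gt0 : 0 < T) (H_gt0 : 0 < H) (S_gt0 : 0 < S).
Hypothesis amp_le : forall k, (0 < k)%N -> amplitude T H k <= S * k%:R `^ (- (H + 2^-1)).

Let q : R := (2 `^ H)^-1.

Let q_gt0 : 0 < q. Proof. by rewrite invr_gt0 powR_gt0. Qed.

Let q_lt1 : q < 1.
Proof.
have : 1 `^ H < 2 `^ H :> R.
  by apply: (gt0_ltr_powR H_gt0); rewrite ?nnegrE// ltr1n.
by rewrite powR1 invf_lt1 ?powR_gt0.
Qed.

Lemma inv_block_rate j : (block_rate H j)^-1 = q ^+ j.
Proof.
rewrite /block_rate natrX -powR_mulrn// -powRrM mulrC powRrM powR_mulrn ?powR_ge0//.
by rewrite exprVn.
Qed.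

Definition tail_const : R := block_const S / (1 - q) ^+ 2.

Lemma block_const_ge0 : 0 <= block_const S.
Proof.
by rewrite /block_const !addr_ge0 ?mulr_ge0 ?sqr_ge0 ?pi_ge0 ?expR_ge0 ?(ltW S_gt0).
Qed.

Lemma tail_const_ge0 : 0 <= tail_const.
Proof. by rewrite divr_ge0 ?block_const_ge0// sqr_ge0. Qed.

(** From [m + i + 1 <= (m + 1) * (i + 1)], the sum from [m] on is at most its
    first term times the sum of the [i.+1%:R * q ^+ i]. *)
Lemma sum_block_le m n :
  \sum_(m <= j < n) block_const S * (Num.sqrt j.+1%:R / block_rate H j) <=
  tail_const * (Num.sqrt m.+1%:R / block_rate H m).
Proof.
rewrite -mulr_sumr /tail_const -mulrA ler_wpM2l ?block_const_ge0//.
have [nm|/ltnW mn] := leqP n m.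
  rewrite big_geq// !mulr_ge0 ?invr_ge0 ?sqr_ge0 ?sqrtr_ge0//.
  exact/ltW/block_rate_gt0.
rewrite -{1}[m]add0n big_addn.
apply: (@le_trans _ _ (\sum_(0 <= i < n - m)
    (Num.sqrt m.+1%:R / block_rate H m) * (i.+1%:R * q ^+ i))).
  apply: ler_sum => i _; rewrite !inv_block_rate exprD.
  have -> : Num.sqrt m.+1%:R * q ^+ m * (i.+1%:R * q ^+ i) =
     (Num.sqrt m.+1%:R * i.+1%:R) * (q ^+ i * q ^+ m) by ring.
  rewrite ler_wpM2r ?mulr_ge0 ?exprn_ge0 ?(ltW q_gt0)//.
  have <- : Num.sqrt (i.+1%:R ^+ 2) = i.+1%:R :> R by rewrite sqrtr_sqr ger0_norm.
  rewrite -sqrtrM// ler_wsqrtr// -natrX -natrM ler_nat; nia.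
rewrite -mulr_sumr mulrC ler_wpM2r//; last exact: sum_arith_geometric_le.
by rewrite divr_ge0 ?sqrtr_ge0// ltW// block_rate_gt0.
Qed.

Context d (Omega : measurableType d) (P : probability Omega R).
Variable Z : int -> {RV P >-> R}.
Hypothesis indepZ : mutually_independent Z.
Hypothesis gaussZ : forall k, standard_gaussian (Z k).

Lemma tail_boundE m w : tail_bound T H S Z m w =
  (\sum_(0 <= j <oo) (if (m <= j)%N then (block_bound T H S Z j w)%:E else 0))%E.
Proof. by rewrite /tail_bound eseries_cond eseries_mkcond. Qed.

Let term_ge0 m j w :
  (0 <= if (m <= j)%N then (block_bound T H S Z j w)%:E else 0)%E.
Proof. by case: ifP => // _; rewrite lee_fin block_bound_ge0. Qed.

Let measurable_term m j : measurable_fun [set: Omega]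
  (fun w => (if (m <= j)%N then (block_bound T H S Z j w)%:E else 0)%E).
Proof.
case: (m <= j)%N; last exact: measurable_cst.
by apply/measurable_EFinP; exact: measurable_block_bound.
Qed.

Lemma measurable_tail_bound m : measurable_fun [set: Omega] (tail_bound T H S Z m).
Proof.
have -> : tail_bound T H S Z m = fun w => (\sum_(0 <= j <oo)
    (if (m <= j)%N then (block_bound T H S Z j w)%:E else 0))%E.
  by apply/funext => w; exact: tail_boundE.
by apply: ge0_emeasurable_sum.
Qed.

Lemma integral_tail_bound m :
  (\int[P]_w tail_bound T H S Z m w <=
   (tail_const * (Num.sqrt m.+1%:R / block_rate H m))%:E)%E.
Proof.
under eq_integral do rewrite tail_boundE.
rewrite integral_nneseries//.
apply: lime_le.
  by apply: is_cvg_nneseries => j _ _; apply: integral_ge0 => w _.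
apply: nearW => n.
apply: (@le_trans _ _ (\sum_(m <= j < n) block_const S * (Num.sqrt j.+1%:R / block_rate H j))%:E).
  rewrite -sumEFin [leRHS](@big_nat_widenl _ _ _ m 0)//= [leRHS]big_mkcond/=.
  apply: lee_sum => j _; case: (m <= j)%N; first exact: integral_block_bound.
  by rewrite integral0.
by rewrite lee_fin sum_block_le.
Qed.

End expected_tail.

Section upper_bound.
Context (R : realType) (T H S : R).
Hypotheses (T_gt0 : 0 < T) (H_gt0 : 0 < H) (S_gt0 : 0 < S).
Hypothesis amp_le : forall k, (0 < k)%N -> amplitude T H k <= S * k%:R `^ (- (H + 2^-1)).

Lemma ln2_ge_half : 2^-1 <= ln 2 :> R.
Proof.
have := @le_ln1Dx R (- 2^-1); have -> : 1 + - 2^-1 = 2^-1 :> R by lra.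
by rewrite lnV ?posrE//; lra.
Qed.

(** For [2 ^ m <= N] with [m > 0] one has [m + 1 <= 2 * m <= 4 * ln N], as
    [ln 2 >= 1 / 2]. *)
Lemma dyadic_rate_le (m N : nat) : (0 < m)%N -> (2 ^ m <= N < 2 ^ m.+1)%N ->
  Num.sqrt m.+1%:R / block_rate H m <=
  2 * 2 `^ H * (N%:R `^ (- H) * Num.sqrt (ln N%:R)).
Proof.
move=> m0 /andP[mN Nm].
have N0 : 0 < N%:R :> R by rewrite ltr0n (leq_trans _ mN)// expn_gt0.
have rate0 := block_rate_gt0 H m.
have lnN : m.+1%:R <= 4 * ln N%:R :> R.
  apply: (@le_trans _ _ (4 * (m%:R * ln 2))).
    have := ln2_ge_half; have : 1 <= m%:R :> R by rewrite ler1n.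
    rewrite -(natr1 m); move: (ln 2) (m%:R : R) => l x; nra.
  rewrite ler_pM2l// mulr_natl -lnXn// ler_ln ?posrE ?exprn_gt0//.
  by rewrite -natrX ler_nat.
have -> : 2 * 2 `^ H * (N%:R `^ (- H) * Num.sqrt (ln N%:R)) =
    Num.sqrt (4 * ln N%:R) * (2 `^ H * N%:R `^ (- H)).
  rewrite sqrtrM// (_ : 4 = 2 ^+ 2) ?sqrtr_sqr ?ger0_norm//; last by lra.
  by ring.
apply: ler_pM; rewrite ?invr_ge0 ?sqrtr_ge0 ?(ltW rate0)// ?ler_wsqrtr//.
rewrite powRN -[leRHS]invf_div lef_pV2 ?posrE// ?divr_gt0 ?powR_gt0//.
rewrite ler_pdivrMr ?powR_gt0// /block_rate -powRM//.
apply: (ge0_ler_powR (ltW H_gt0)); rewrite ?nnegrE ?mulr_ge0//.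
by rewrite -natrM ler_nat mulnC -expnS ltnW.
Qed.

Definition upper_const : R := 2 * tail_const H S * (2 * 2 `^ H).

Context d (Omega : measurableType d) (P : probability Omega R).
Variable Z : int -> {RV P >-> R}.
Hypothesis indepZ : mutually_independent Z.
Hypothesis gaussZ : forall k, standard_gaussian (Z k).

Lemma ae_tail_bound_lty : {ae P, forall w, (tail_bound T H S Z 0 w < +oo)%E}.
Proof.
have intV : P.-integrable setT (tail_bound T H S Z 0).
  apply/integrableP; split; first exact: measurable_tail_bound.
  under eq_integral do rewrite gee0_abs ?tail_bound_ge0//.
  apply: le_lt_trans (integral_tail_bound _ _ _ amp_le indepZ gaussZ 0) _ => //.
  exact: ltry.
have := integrable_ae measurableT intV; apply: filterS => w /(_ I).
by rewrite ge0_fin_numE// tail_bound_ge0.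
Qed.

Lemma sup_error_ge0 N w : (0 <= sup_error T H Z N w)%E.
Proof.
apply: (@le_trans _ _ (`|limit_process T H Z 0 w - partial_process T H Z N 0 w|)%:E).
  by rewrite lee_fin.
by apply: ereal_sup_ubound; exists 0 => //=; rewrite in_itv/= lexx ltW.
Qed.

Lemma integral_sup_error_le N : (2 <= N)%N ->
  (\int[P]_w sup_error T H Z N w <=
   (upper_const * (N%:R `^ (- H) * Num.sqrt (ln N%:R)))%:E)%E.
Proof.
move=> N2; have N0 : (0 < N)%N by exact: ltnW.
have /andP[m1 m2] := trunc_log_bounds (isT : 1 < 2)%N N0.
set m := trunc_log 2 N in m1 m2.
have m0 : (0 < m)%N by apply: trunc_log_max.
apply: (@le_trans _ _ (\int[P]_w (2%:E * tail_bound T H S Z m w))%E).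
  apply: ge0_le_integral_nonmeasurable => w; first exact: sup_error_ge0.
  by apply: sup_error_le => //; rewrite m1 ltnW.
rewrite ge0_integralZl//; last 2 first.
- exact: measurable_tail_bound.
- by move=> w _; exact: tail_bound_ge0.
apply: (@le_trans _ _ (2%:E * (tail_const H S * (Num.sqrt m.+1%:R / block_rate H m))%:E)%E).
  by rewrite lee_wpmul2l ?lee_fin//; exact: integral_tail_bound.
rewrite -EFinM lee_fin /upper_const [leLHS]mulrA -[leRHS]mulrA ler_wpM2l//.
  by rewrite mulr_ge0// tail_const_ge0.
by apply: dyadic_rate_le => //; rewrite m1.
Qed.

End upper_bound.

(** * Orthogonality of sines on a grid *)

Section sine_orthogonality.
Context (R : realType).

Lemma sin_natpiD (n : nat) (x : R) : sin (pi * n%:R + x) = (-1) ^+ n * sin x.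
Proof. by rewrite sinD sin_natpi cos_natpi mul0r add0r. Qed.

Lemma sum_cos_telescope (x : R) (n : nat) :
  2 * sin (x / 2) * \sum_(0 <= l < n) cos (l%:R * x) =
  sin (n%:R * x - x / 2) + sin (x / 2).
Proof.
elim: n => [|n IH].
  by rewrite big_nil mulr0 mul0r add0r sinN addNr.
rewrite big_nat_recr//= mulrDr IH.
have -> : n.+1%:R * x - x / 2 = n%:R * x + x / 2.
  by rewrite -(natr1 n) mulrDl mul1r; lra.
by rewrite sinB sinD; ring.
Qed.

(** At the [N] grid points of the half circle only the parity of [p] matters. *)
Lemma sum_cos_grid (N p : nat) : (0 < p < 2 * N)%N ->
  \sum_(0 <= l < N) cos (l%:R * (p%:R * pi / N%:R)) = (1 - (-1) ^+ p) / 2 :> R.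
Proof.
move=> /andP[p0 pN].
have N0 : 0 < N%:R :> R by rewrite ltr0n; move: p0 pN; case: N.
have pi0 := pi_gt0 R.
set x := p%:R * pi / N%:R.
have sx : 0 < sin (x / 2).
  apply: sin_gt0_pi; rewrite /x; apply/andP; split.
    by rewrite !divr_gt0// mulr_gt0// ltr0n.
  rewrite -mulrA -invfM ltr_pdivrMr ?mulr_gt0// [ltRHS]mulrC ltr_pM2r//.
  by rewrite mulrC -natrM ltr_nat.
apply: (@mulfI _ (2 * sin (x / 2))); first by rewrite mulf_neq0// gt_eqF.
rewrite sum_cos_telescope.
have -> : N%:R * x = pi * p%:R by rewrite /x mulrC divfK ?gt_eqF// mulrC.
rewrite sin_natpiD sinN; lra.
Qed.

(** Shifting [k] by [N] turns the frequencies between [N] and [2 N] into those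
    below [N] up to signs.  The product of sines is half the difference of the
    cosines of frequencies [i - j] and [i + j], whose sums agree when [i <> j]
    because these numbers have the same parity. *)
Lemma sum_sin_grid (N i j : nat) : (0 < i < N)%N -> (0 < j < N)%N ->
  \sum_(N.+1 <= k < N.*2) sin (k%:R * (i%:R * pi / N%:R)) * sin (k%:R * (j%:R * pi / N%:R)) =
  (if i == j then N%:R / 2 else 0) :> R.
Proof.
wlog ji : i j / (j <= i)%N.
  move=> h iN jN; have [/h/(_ iN jN)//|/ltnW/h/(_ jN iN)] := leqP j i.
  by rewrite eq_sym => <-; apply: eq_bigr => k _; rewrite mulrC.
move=> /andP[i0 iN] /andP[j0 jN].
have N0 : 0 < N%:R :> R by rewrite ltr0n (leq_trans _ iN).
have shift (k q : nat) : sin ((k + N)%:R * (q%:R * pi / N%:R)) =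
    (-1) ^+ q * sin (k%:R * (q%:R * pi / N%:R)) :> R.
  rewrite -sin_natpiD natrD mulrDl addrC; congr (sin (_ + _)).
  by field; rewrite gt_eqF.
pose C (p : nat) : R := \sum_(0 <= l < N) cos (l%:R * (p%:R * pi / N%:R)).
have -> : \sum_(N.+1 <= k < N.*2) sin (k%:R * (i%:R * pi / N%:R)) *
    sin (k%:R * (j%:R * pi / N%:R)) =
    (-1) ^+ (i + j) * (C (i - j)%N - C (i + j)%N) / 2 :> R.
  transitivity (\sum_(N <= k < N.*2) sin (k%:R * (i%:R * pi / N%:R)) *
      sin (k%:R * (j%:R * pi / N%:R)) : R).
    rewrite [RHS]big_ltn; last by lia.
    rewrite [X in sin X * _](_ : _ = pi * i%:R); last by field; rewrite gt_eqF.
    by rewrite sin_natpi mul0r add0r.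
  rewrite -{1}[N]add0n big_addn -addnn addnK /C -sumrB [RHS]mulrAC [RHS]mulr_sumr.
  apply: eq_bigr => l _; rewrite !shift exprD.
  have -> : l%:R * ((i - j)%:R * pi / N%:R) =
      l%:R * (i%:R * pi / N%:R) - l%:R * (j%:R * pi / N%:R) :> R.
    by rewrite natrB//; ring.
  have -> : l%:R * ((i + j)%:R * pi / N%:R) =
      l%:R * (i%:R * pi / N%:R) + l%:R * (j%:R * pi / N%:R) :> R.
    by rewrite natrD; ring.
  by rewrite cosB cosD; field.
rewrite [C (i + j)%N]sum_cos_grid; last by lia.
case: eqVneq => [<-|ij].
  rewrite subnn /C; under eq_bigr do rewrite !mul0r mulr0 cos0.
  rewrite sumr_const_nat subn0 addnn -mul2n exprM sqrrN !expr1n subrr mul0r.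
  by rewrite subr0 mul1r.
rewrite [C (i - j)%N]sum_cos_grid; last by lia.
have -> : (-1) ^+ (i - j) = (-1) ^+ (i + j) :> R.
  by rewrite -signr_odd -[RHS]signr_odd oddB// oddD.
by rewrite subrr mulr0 mul0r.
Qed.

End sine_orthogonality.

(** * A second-moment change of measure *)

Section tilted_union.
Context d (Omega : measurableType d) (R : realType) (P : probability Omega R).

Lemma integral_sum_EFin (I : Type) (s : seq I) (F : I -> Omega -> R) :
  (forall i, measurable_fun [set: Omega] (F i)) -> (forall i w, 0 <= F i w) ->
  (\int[P]_w (\sum_(i <- s) F i w)%:E = \sum_(i <- s) \int[P]_w (F i w)%:E)%E.
Proof.
move=> mF F0; under eq_integral do rewrite -sumEFin.
rewrite ge0_integral_sum//.
  by move=> i; exact/measurable_EFinP.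
by move=> i w _; rewrite lee_fin.
Qed.

Lemma integralD_le (f g : Omega -> R) (a b : R) :
  measurable_fun [set: Omega] f -> measurable_fun [set: Omega] g ->
  (forall w, 0 <= f w) -> (forall w, 0 <= g w) ->
  (\int[P]_w (f w)%:E <= a%:E)%E -> (\int[P]_w (g w)%:E <= b%:E)%E ->
  (\int[P]_w (f w + g w)%:E <= (a + b)%:E)%E.
Proof.
move=> mf mg f0 g0 fa gb; under eq_integral do rewrite EFinD.
rewrite ge0_integralD//; last 4 first.
- by move=> w _; rewrite lee_fin.
- exact/measurable_EFinP.
- by move=> w _; rewrite lee_fin.
- exact/measurable_EFinP.
by rewrite EFinD; exact: leeD.
Qed.

(** Let [L] be the average of the densities [e i].  Outside [A] it is at most the
    average of the [g i], of mean at most [1 / 4]; on [A] it is at most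
    [L ^+ 2 / (2 * K) + K / 2].  Since [L] has mean [1] and [L ^+ 2] has mean at
    most [K], this leaves [K / 2 * P A >= 1 / 4]. *)
Lemma tilted_union_ge (s : seq nat) (e g : nat -> Omega -> R) (A : set Omega) (D : R)
    (K := 1 + D / (size s)%:R) :
  uniq s -> (0 < size s)%N -> 0 <= D -> measurable A ->
  (forall i, measurable_fun [set: Omega] (e i)) -> (forall i w, 0 <= e i w) ->
  (forall i, measurable_fun [set: Omega] (g i)) -> (forall i w, 0 <= g i w) ->
  (forall i, i \in s -> \int[P]_w (e i w)%:E = 1)%E ->
  (forall i, i \in s -> \int[P]_w (g i w)%:E <= (4^-1)%:E)%E ->
  (forall i j, i \in s -> j \in s ->
    \int[P]_w (e i w * e j w)%:E <= (if i == j then D else 1)%:E)%E ->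
  (forall w i, ~ A w -> i \in s -> e i w <= g i w) ->
  (((2 * K)^-1)%:E <= P A)%E.
Proof.
move=> us; set m : R := (size s)%:R => s0 D0 mA me e0 mg g0 e1 g4 ee eg.
have m0 : 0 < m by rewrite ltr0n.
have K1 : 1 <= K by rewrite lerDl divr_ge0// ltW.
have K0 : 0 < K by lra.
pose L w := m^-1 * \sum_(i <- s) e i w.
pose G w := m^-1 * \sum_(i <- s) g i w.
pose Q w := \sum_(i <- s) \sum_(j <- s) (e i w * e j w).
have LQ w : L w ^+ 2 = m ^- 2 * Q w.
  rewrite /L exprMn -exprVn; congr (_ * _); rewrite expr2 mulr_suml.
  by apply: eq_bigr => i _; rewrite mulr_sumr.
have L0 w : 0 <= L w by rewrite mulr_ge0 ?invr_ge0 ?(ltW m0)// sumr_ge0.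
have G0 w : 0 <= G w by rewrite mulr_ge0 ?invr_ge0 ?(ltW m0)// sumr_ge0.
have Q0 w : 0 <= Q w.
  by apply: sumr_ge0 => i _; apply: sumr_ge0 => j _; rewrite mulr_ge0.
have pw w : L w <= G w + ((2 * K * m ^+ 2)^-1 * Q w + K / 2 * \1_A w).
  have QE : (2 * K * m ^+ 2)^-1 * Q w = L w ^+ 2 / (2 * K).
    by rewrite LQ invfM -[LHS]mulrA [LHS]mulrC.
  rewrite QE indicE; case: (boolP (w \in A)) => /= [_|/negP wA].
    rewrite mulr1; apply: (@le_trans _ _ (L w ^+ 2 / (2 * K) + K / 2)); last by rewrite lerDr.
    have : 0 <= (L w / K - 1) ^+ 2 by exact: sqr_ge0.
    have -> : L w ^+ 2 / (2 * K) + K / 2 = L w + (L w / K - 1) ^+ 2 * K / 2.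
      by field; rewrite gt_eqF.
    by move=> h; rewrite lerDl divr_ge0// mulr_ge0// ltW.
  rewrite mulr0 addr0 (@le_trans _ _ (G w))//.
    rewrite /L /G ler_wpM2l ?invr_ge0 ?(ltW m0)// big_seq [leRHS]big_seq.
    apply: ler_sum => i si; apply: eg => //.
    by move=> Aw; apply: wA; exact: mem_set.
  by rewrite lerDl divr_ge0 ?sqr_ge0// mulr_ge0// ltW.
have mL : measurable_fun [set: Omega] L.
  by apply: measurable_funM => //; exact: measurable_sum.
have mG : measurable_fun [set: Omega] G.
  by apply: measurable_funM => //; exact: measurable_sum.
have mQ : measurable_fun [set: Omega] Q.
  apply: measurable_sum => i; apply: measurable_sum => j.
  exact: measurable_funM.
have intL : (\int[P]_w (L w)%:E = 1)%E.
  under eq_integral do rewrite EFinM.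
  rewrite ge0_integralZl//; last 3 first.
  - by apply/measurable_EFinP; exact: measurable_sum.
  - by move=> w _; rewrite lee_fin sumr_ge0.
  - by rewrite lee_fin invr_ge0 ltW.
  rewrite integral_sum_EFin// big_seq (eq_bigr (fun=> 1%:E))//.
  rewrite -big_seq sumEFin big_const_seq count_predT iter_addr_0 -EFinM.
  by rewrite -/m mulVf ?gt_eqF.
have intG : (\int[P]_w (G w)%:E <= (4^-1)%:E)%E.
  have -> : 4^-1 = 0 + m^-1 * \sum_(i <- s) 4^-1 :> R.
    rewrite big_const_seq count_predT iter_addr_0 -(mulr_natr 4^-1) -/m add0r.
    by rewrite mulrCA mulVf ?gt_eqF// mulr1.
  under eq_integral do rewrite /G -[m^-1 * _]add0r.
  apply: integral_affine_le => //; first by rewrite invr_ge0 ltW.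
  - exact: measurable_sum.
  - by move=> w; exact: sumr_ge0.
  exact: integral_sum_le.
have intQ : (\int[P]_w (Q w)%:E <= (m ^+ 2 + m * D)%:E)%E.
  apply: (@le_trans _ _ (\sum_(i <- s) \sum_(j <- s) (if i == j then D else 1))%:E).
    apply: integral_sum_le => [i|i w|i si].
    - by apply: measurable_sum => j; exact: measurable_funM.
    - by apply: sumr_ge0 => j _; rewrite mulr_ge0.
    apply: integral_sum_le => [j|j w|j sj]; [exact: measurable_funM|exact: mulr_ge0|].
    exact: ee.
  rewrite lee_fin (@le_trans _ _ (\sum_(i <- s) (m + D)))//.
    rewrite big_seq [leRHS]big_seq; apply: ler_sum => i si.
    rewrite (bigD1_seq i)//= eqxx addrC lerD//.
    rewrite (eq_bigr (fun=> 1)); last by move=> j; rewrite eq_sym => /negPf ->.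
    rewrite -big_filter big_const_seq count_predT iter_addr_0 -/m.
    by rewrite /m ler_nat size_filter count_size.
  rewrite big_const_seq count_predT iter_addr_0 -[_ *+ _]mulr_natr -/m.
  by rewrite le_eqVlt; apply/orP; left; apply/eqP; ring.
have intA : (\int[P]_w (\1_A w)%:E = P A)%E by rewrite integral_indic// setIT.
have PA : P A \is a fin_num by exact: fin_num_measure.
have mI : measurable_fun [set: Omega] (\1_A : Omega -> R) by exact: measurable_indic.
have I0 w : 0 <= \1_A w :> R by rewrite indicE.
have mQ' : measurable_fun [set: Omega] (fun w => (2 * K * m ^+ 2)^-1 * Q w).
  exact: measurable_funM.
have mA' : measurable_fun [set: Omega] (fun w => K / 2 * \1_A w).
  exact: measurable_funM.
have cQ0 : 0 <= (2 * K * m ^+ 2)^-1 by rewrite invr_ge0 !mulr_ge0 ?sqr_ge0 ?(ltW K0).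
have cA0 : 0 <= K / 2 by rewrite divr_ge0// ltW.
have intQ' : (\int[P]_w ((2 * K * m ^+ 2)^-1 * Q w)%:E <= (2^-1)%:E)%E.
  have -> : 2^-1 = 0 + (2 * K * m ^+ 2)^-1 * (m ^+ 2 + m * D) :> R.
    by rewrite /K; field; rewrite !gt_eqF//= -/K; nra.
  under eq_integral do rewrite -[_ * Q _]add0r.
  exact: integral_affine_le.
have intA' : (\int[P]_w (K / 2 * \1_A w)%:E <= (K / 2 * fine (P A))%:E)%E.
  rewrite -[_ * fine _]add0r; under eq_integral do rewrite -[_ * \1_A _]add0r.
  apply: integral_affine_le => //.
  by rewrite intA fineK.
have intR := integralD_le mQ' mA' (fun w => mulr_ge0 cQ0 (Q0 w))
  (fun w => mulr_ge0 cA0 (I0 w)) intQ' intA'.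
have intS : (\int[P]_w (L w)%:E <= (4^-1 + (2^-1 + K / 2 * fine (P A)))%:E)%E.
  apply: le_trans (integralD_le mG (measurable_funD mQ' mA') G0 _ intG intR).
    apply: ge0_le_integral => //.
    - by move=> w _; rewrite lee_fin.
    - exact/measurable_EFinP.
    - by apply/measurable_EFinP; apply: measurable_funD => //; exact: measurable_funD.
    - by move=> w _; rewrite lee_fin.
  by move=> w; rewrite addr_ge0// mulr_ge0.
rewrite -(fineK PA) lee_fin; move: intS; rewrite intL lee_fin => h.
have : 4^-1 <= K / 2 * fine (P A) by lra.
rewrite -ler_pdivrMl ?divr_gt0// => h2; apply: le_trans h2.
by rewrite le_eqVlt; apply/orP; left; apply/eqP; field; rewrite gt_eqF.
Qed.

End tilted_union.

(** * The maximum of the error over the grid *)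

(** The right-hand side is the integral of [x `^ (- (1 + a))] over
    [[k, k + 1]], and the integrand is least at [k + 1].  The inequalities
    [1 + x <= expR x] and [ln (1 + x) <= x] do the work of the integral. *)
Lemma inverse_power_telescope (R : realType) (a : R) (k : nat) : 0 < a -> (0 < k)%N ->
  k.+1%:R `^ (- (1 + a)) <= a^-1 * (k%:R `^ (- a) - k.+1%:R `^ (- a)).
Proof.
move=> a0 k0; have k0' : 0 < k%:R :> R by rewrite ltr0n.
have kS0 : 0 < k.+1%:R :> R by [].
have kS : k.+1%:R = k%:R + 1 :> R by rewrite natr1.
have x_lt : -1 < - k.+1%:R^-1 :> R by rewrite ltrN2 invf_lt1// ltr1n ltnS.
have ln_le := le_ln1Dx x_lt.
have ratio : k%:R = k.+1%:R * (1 + - k.+1%:R^-1) :> R.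
  by rewrite mulrDr mulr1 mulrN mulfV ?gt_eqF// kS; ring.
have y0 : 0 < 1 + - k.+1%:R^-1 :> R by rewrite -(pmulr_rgt0 _ kS0) -ratio.
rewrite ler_pdivlMl// mulrC {1}ratio powRM ?(ltW y0)//.
rewrite -[in X in _ <= _ - X](mulr1 (_ `^ _)) -mulrBr opprD powRD; last first.
  by rewrite (gt_eqF kS0) implybT.
rewrite [_ `^ (-1) * _]mulrC -mulrA ler_wpM2l ?powR_ge0// powR_inv1//.
rewrite /powR (gt_eqF y0) lerBrDl.
apply: le_trans (expR_ge1Dx _); rewrite lerD2l mulNr -mulrN mulrC ler_wpM2l ?(ltW a0)//.
by rewrite lerNr.
Qed.

Section lower_probability.
Context (R : realType) (T H s S : R).
Hypotheses (T_gt0 : 0 < T) (H_gt0 : 0 < H) (s_gt0 : 0 < s) (S_gt0 : 0 < S).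
Hypothesis amp_le : forall k, (0 < k)%N -> amplitude T H k <= S * k%:R `^ (- (H + 2^-1)).
Hypothesis amp_ge : forall k, (2 <= k)%N -> s * k%:R `^ (- (H + 2^-1)) <= amplitude T H k.

Lemma sum_amplitude_tail (N n : nat) : (0 < N)%N -> (N <= n)%N ->
  \sum_(N.+1 <= k < n.+1) amplitude T H k ^+ 2 <= S ^+ 2 / (2 * H) * (N%:R `^ (- H)) ^+ 2.
Proof.
move=> N0 Nn; have H2 : 0 < 2 * H by rewrite mulr_gt0.
apply: (@le_trans _ _ (\sum_(N <= k < n)
    S ^+ 2 / (2 * H) * (k%:R `^ (- (2 * H)) - k.+1%:R `^ (- (2 * H))))).
  rewrite big_add1/=; apply: ler_sum_nat => k /andP[Nk _].
  have k0 : (0 < k)%N by exact: leq_trans Nk.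
  apply: (@le_trans _ _ ((S * k.+1%:R `^ (- (H + 2^-1))) ^+ 2)).
    by rewrite ler_sqr ?nnegrE ?amplitude_ge0 ?amp_le// mulr_ge0 ?powR_ge0// ltW.
  rewrite exprMn -mulrA ler_wpM2l ?sqr_ge0//.
  rewrite -powR_mulrn ?powR_ge0// -powRrM.
  have -> : - (H + 2^-1) * 2 = - (1 + 2 * H) by lra.
  exact: inverse_power_telescope.
rewrite -mulr_sumr ler_wpM2l ?divr_ge0 ?sqr_ge0 ?(ltW H2)//.
have -> : (N%:R `^ (- H)) ^+ 2 = N%:R `^ (- (2 * H)) :> R.
  by rewrite -powR_mulrn ?powR_ge0// -powRrM; congr (_ `^ _); lra.
under eq_bigr do rewrite -opprB.
by rewrite sumrN telescope_sumr// opprB gerBl powR_ge0.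
Qed.

(** The unit vector along which the Gaussian family is shifted in order to push
    up the error at [grid_time N i]. *)
Definition tilt_coord (N i k : nat) : R :=
  if (k < N.*2)%N then Num.sqrt (2 / N%:R) * sin (k%:R * (i%:R * pi / N%:R)) else 0.

Definition grid_time (N i : nat) : R := i%:R * T / N%:R.

Let restrict_sum (N n : nat) (F : nat -> R) : (0 < N)%N -> (N.*2 <= n)%N ->
  \sum_(N.+1 <= k < n.+1) (if (k < N.*2)%N then F k else 0) =
  \sum_(N.+1 <= k < N.*2) F k.
Proof.
move=> N0 Nn; rewrite (@big_cat_nat _ _ _ N.*2)/=; [|lia|lia].
rewrite [X in _ + X]big_nat_cond [X in _ + X]big1 ?addr0; last first.
  by move=> k /andP[/andP[Nk _] _]; rewrite ltnNge Nk.
by apply: eq_big_nat => k /andP[_ ->].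
Qed.

Lemma tilt_coord_orthonormal N n i j : (N.*2 <= n)%N -> (0 < i < N)%N -> (0 < j < N)%N ->
  \sum_(N.+1 <= k < n.+1) tilt_coord N i k * tilt_coord N j k = (i == j)%:R.
Proof.
move=> Nn iN jN; have N0 : (0 < N)%N by move: iN; case: N {Nn jN} => //; lia.
have N0' : 0 < N%:R :> R by rewrite ltr0n.
pose F k := 2 / N%:R * (sin (k%:R * (i%:R * pi / N%:R)) * sin (k%:R * (j%:R * pi / N%:R))) : R.
rewrite (eq_bigr (fun k => if (k < N.*2)%N then F k else 0)); last first.
  move=> k _; rewrite /tilt_coord; case: ifP => _; last by rewrite mul0r.
  by rewrite mulrACA -expr2 sqr_sqrtr// divr_ge0.
rewrite restrict_sum// -mulr_sumr sum_sin_grid//.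
by case: eqVneq => _; [rewrite mulrA divfK ?gt_eqF// mulfV|rewrite mulr0].
Qed.

(** All terms are nonnegative, so every amplitude may be replaced by its smallest
    bound, at frequency [2 N]; what remains is the sum of the squared sines. *)
Lemma tilt_coord_mean N n i : (2 <= N)%N -> (N.*2 <= n)%N -> (0 < i < N)%N ->
  s * 2 `^ (- H) / 2 * N%:R `^ (- H) <=
  \sum_(N.+1 <= k < n.+1) tilt_coord N i k * sin_coord T H (grid_time N i) k.
Proof.
move=> N2 Nn iN; have N0 : (0 < N)%N by exact: ltnW.
have N0' : 0 < N%:R :> R by rewrite ltr0n.
have T0 : T != 0 by rewrite gt_eqF.
have argE (k : nat) : k%:R * pi * grid_time N i / T = k%:R * (i%:R * pi / N%:R).
  rewrite /grid_time; move: (pi) (k%:R : R) => p x; field.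
  by rewrite T0 gt_eqF.
pose sn (k : nat) : R := sin (k%:R * (i%:R * pi / N%:R)).
pose F k := Num.sqrt (2 / N%:R) * (amplitude T H k * (sn k * sn k)) : R.
rewrite [leRHS](eq_bigr (fun k => if (k < N.*2)%N then F k else 0)); last first.
  move=> k _; rewrite /tilt_coord /sin_coord argE; case: ifP => _; last by rewrite mul0r.
  by rewrite /F -/(sn k); ring.
rewrite restrict_sum//.
pose amin : R := s * N.*2%:R `^ (- (H + 2^-1)).
have amin0 : 0 < amin by rewrite mulr_gt0 ?powR_gt0// ltr0n double_gt0.
apply: (@le_trans _ _ (Num.sqrt (2 / N%:R) * (amin * (N%:R / 2)))).
  have sq_half : Num.sqrt (2 / N%:R) * N.*2%:R `^ (- 2^-1) = N%:R^-1 :> R.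
    rewrite powRN powR12_sqrt// -sqrtrV// -sqrtrM ?divr_ge0//.
    have -> : 2 / N%:R / N.*2%:R = N%:R^-1 ^+ 2 :> R.
      by rewrite -mul2n natrM; field; rewrite gt_eqF.
    by rewrite sqrtr_sqr ger0_norm// invr_ge0.
  have pow_split : N.*2%:R `^ (- (H + 2^-1)) = N.*2%:R `^ (- 2^-1) * (2 `^ (- H) * N%:R `^ (- H)) :> R.
    rewrite -powRM// -natrM mul2n -powRD; last by rewrite pnatr_eq0 double_eq0 -lt0n N0 implybT.
    by congr (_ `^ _); ring.
  have -> : Num.sqrt (2 / N%:R) * (amin * (N%:R / 2)) =
     s * ((Num.sqrt (2 / N%:R) * N.*2%:R `^ (- 2^-1)) * N%:R) *
     (2 `^ (- H) * N%:R `^ (- H)) / 2.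
    by rewrite /amin pow_split; ring.
  rewrite sq_half mulVf ?gt_eqF// mulr1.
  by rewrite le_eqVlt; apply/orP; left; apply/eqP; ring.
rewrite -mulr_sumr ler_wpM2l ?sqrtr_ge0//.
have := sum_sin_grid R iN iN; rewrite eqxx => <-.
rewrite mulr_sumr; apply: ler_sum_nat => k /andP[Nk kN].
rewrite -/(sn k) ler_wpM2r// -?expr2 ?sqr_ge0//.
have k0 : (0 < k)%N by lia.
apply: le_trans (amp_ge (leq_trans N2 (ltnW Nk))).
rewrite /amin ler_wpM2l ?(ltW s_gt0)// !powRN lef_pV2 ?posrE ?powR_gt0 ?ltr0n ?double_gt0//.
have H0 : 0 <= H + 2^-1 by rewrite addr_ge0// ltW.
by apply: (ge0_ler_powR H0); rewrite ?nnegrE ?ler_nat// ltnW.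
Qed.

(** [mean_const] bounds from below the mean of the error at a grid time after a
    unit shift, in units of [N%:R `^ (- H)], and [variance_const] bounds from
    above its variance, in units of the square of that.  [chernoff_const] is the
    resulting exponent in the Chernoff bound, optimised over the exponential
    parameter. *)
Definition mean_const : R := s * 2 `^ (- H) / 2.
Definition variance_const : R := 2 * S ^+ 2 / H.
Definition chernoff_const : R := mean_const ^+ 2 / (8 * variance_const).
(** Large enough for the Chernoff bound [expR (- base_tilt * chernoff_const)] to
    be below [expR (- 2)], hence below [1 / 4], even for small [N]; the summand
    [1] makes [tilt_level N] at least [sqrt (ln N)]. *)
Definition base_tilt : R := 2 / chernoff_const + 1.
Definition tilt_level (N : nat) : R := Num.sqrt (base_tilt + ln N.-1%:R).
(** Half of the lower bound on the mean of the error after the shift. *)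
Definition threshold (N : nat) : R := tilt_level N * mean_const * N%:R `^ (- H) / 2.
Definition overlap_const : R := 1 + expR base_tilt.

Lemma mean_const_gt0 : 0 < mean_const.
Proof. by rewrite divr_gt0// mulr_gt0// powR_gt0. Qed.

Lemma variance_const_gt0 : 0 < variance_const.
Proof. by rewrite divr_gt0// mulr_gt0// exprn_gt0. Qed.

Lemma chernoff_const_gt0 : 0 < chernoff_const.
Proof.
apply: divr_gt0; first exact/exprn_gt0/mean_const_gt0.
by apply: mulr_gt0 => //; exact: variance_const_gt0.
Qed.

Lemma base_tilt_gt0 : 0 < base_tilt.
Proof. by rewrite addr_gt0// divr_gt0// chernoff_const_gt0. Qed.

Lemma tilt_level_sqr N : (2 <= N)%N -> tilt_level N ^+ 2 = base_tilt + ln N.-1%:R.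
Proof.
move=> N2; rewrite sqr_sqrtr//; apply: addr_ge0; first exact: ltW base_tilt_gt0.
by apply: ln_ge0; rewrite ler1n; case: N N2 => [|[]].
Qed.

Context d (Omega : measurableType d) (P : probability Omega R).
Variable Z : int -> {RV P >-> R}.
Hypothesis indepZ : mutually_independent Z.
Hypothesis gaussZ : forall k, standard_gaussian (Z k).

Lemma integral_expR_affine (c v : R) (a b : nat -> R) (m n : nat) : (0 < m)%N ->
  c + (\sum_(m <= k < n) (a k ^+ 2 + b k ^+ 2)) / 2 = v ->
  (\int[P]_w (expR (c + gaussian_sum Z a b m n w))%:E = (expR v)%:E)%E.
Proof.
move=> m0 <-; under eq_integral do rewrite expRD EFinM.
rewrite ge0_integralZl//; last first.
  by apply/measurable_EFinP; apply: measurableT_comp => //; exact: measurable_gaussian_sum.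
by rewrite (integral_expR_gaussian_sum indepZ gaussZ)// -EFinM -expRD mulr_suml.
Qed.

(** Apply [tilted_union_ge] with [e i] the density of the shift along
    [tilt_coord N i] and [g i] this density times the Chernoff majorant
    [expR (b * (a - X i))] of the indicator of [X i <= a].  With
    [tilt_level N ^+ 2 = base_tilt + ln N.-1%:R] the diagonal terms contribute
    [expR base_tilt] to the second moment. *)
Lemma grid_maximum_prob N n : (2 <= N)%N -> (N.*2 <= n)%N ->
  (((2 * overlap_const)^-1)%:E <=
   P (\bigcup_(i in [set i | (0 < i < N)%N])
        [set w | (threshold N < increment T H Z (grid_time N i) N n w)%R]))%E.
Proof.
move=> N2 Nn; set A := \bigcup_(i in _) _.
have N0 : (0 < N)%N by exact: ltnW.
set l := tilt_level N; set a := threshold N.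
have l2 : l ^+ 2 = base_tilt + ln N.-1%:R by exact: tilt_level_sqr.
pose r : R := N%:R `^ (- H).
have r0 : 0 < r by rewrite powR_gt0// ltr0n.
(* the minimiser of the Chernoff exponent, a quadratic polynomial in [b] *)
pose b : R := l * (mean_const / (2 * variance_const)) / r.
pose U i := gaussian_sum Z (tilt_coord N i) (fun=> 0) N.+1 n.+1.
pose X i := increment T H Z (grid_time N i) N n.
pose e i w := expR (l * U i w - l ^+ 2 / 2).
pose g i w := expR (l * U i w - l ^+ 2 / 2 + b * (a - X i w)).
have mU i : measurable_fun [set: Omega] (U i) by exact: measurable_gaussian_sum.
have mX i : measurable_fun [set: Omega] (X i) by exact: measurable_gaussian_sum.
have me i : measurable_fun [set: Omega] (e i).
  by apply: measurableT_comp => //; apply: measurable_funB => //; exact: measurable_funM.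
have mg i : measurable_fun [set: Omega] (g i).
  apply: measurableT_comp => //; apply: measurable_funD.
    by apply: measurable_funB => //; exact: measurable_funM.
  by apply: measurable_funM => //; exact: measurable_funB.
have mA : measurable A.
  apply: bigcup_measurable => i _.
  have -> : [set w | a < X i w] = [set: Omega] `&` X i @^-1` `]a, +oo[.
    by apply/seteqP; split=> w /=; rewrite in_itv/= andbT; [split|case].
  exact: mX.
have mem_s i : i \in index_iota 1 N = (0 < i < N)%N by rewrite mem_index_iota.
have size_s : size (index_iota 1 N) = N.-1 by rewrite size_iota subn1.
have m0 : 0 < N.-1%:R :> R by rewrite ltr0n; case: N N2 {Nn A N0 l a l2 r r0 b U X e g mU mX me mg mA mem_s size_s} => [|[]].
have -> : overlap_const = 1 + expR (l ^+ 2) / (size (index_iota 1 N))%:R.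
  by rewrite size_s l2 expRD lnK ?posrE// mulfK ?gt_eqF.
have l0 : 0 <= l by exact: sqrtr_ge0.
have mc0 := mean_const_gt0; have vc0 := variance_const_gt0.
have b0 : 0 <= b.
  apply: divr_ge0; last exact: ltW.
  by apply: mulr_ge0 => //; apply: divr_ge0; [exact: ltW|rewrite mulr_ge0// ltW].
have g_split (x1 x2 x3 x4 x5 : R) :
    x1 * x2 - x1 ^+ 2 / 2 + x3 * (x4 - x5) = x3 * x4 - x1 ^+ 2 / 2 + (x1 * x2 + - x3 * x5).
  by ring.
have orth i j := tilt_coord_orthonormal (i := i) (j := j) Nn.
have orth1 i : (0 < i < N)%N ->
    \sum_(N.+1 <= k < n.+1) tilt_coord N i k * tilt_coord N i k = 1.
  by move=> iN; rewrite (orth _ _ iN iN) eqxx.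
apply: (@tilted_union_ge _ _ _ _ _ e g) => //.
- exact: iota_uniq.
- by rewrite size_s -(ltr0n R).
- by move=> i w; exact: expR_ge0.
- by move=> i w; exact: expR_ge0.
- move=> i; rewrite mem_s => iN.
  under eq_integral => w _ do rewrite /e addrC /U -gaussian_sumZ.
  rewrite (@integral_expR_affine _ 0) ?expR0//.
  rewrite (eq_bigr (fun k => l ^+ 2 * (tilt_coord N i k * tilt_coord N i k))); last first.
    by move=> k _; ring.
  rewrite -mulr_sumr (orth1 _ iN) mulr1; ring.
- move=> i; rewrite mem_s => iN.
  pose vsum := \sum_(N.+1 <= k < n.+1)
    (sin_coord T H (grid_time N i) k ^+ 2 + cos_coord T H (grid_time N i) k ^+ 2).
  pose msum := \sum_(N.+1 <= k < n.+1) tilt_coord N i k * sin_coord T H (grid_time N i) k.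
  under eq_integral => w _.
    rewrite (_ : g i w = expR ((b * a - l ^+ 2 / 2) + gaussian_sum Z
      (fun k => l * tilt_coord N i k + - b * sin_coord T H (grid_time N i) k)
      (fun k => l * 0 + - b * cos_coord T H (grid_time N i) k) N.+1 n.+1 w)); last first.
      by rewrite gaussian_sumD !gaussian_sumZ /g; congr expR; exact: g_split.
    over.
  rewrite (@integral_expR_affine _ (b * a - l * b * msum + b ^+ 2 * vsum / 2))//; last first.
    rewrite (eq_bigr (fun k => l ^+ 2 * (tilt_coord N i k * tilt_coord N i k) +
      (- (2 * l * b) * (tilt_coord N i k * sin_coord T H (grid_time N i) k) +
       b ^+ 2 * (sin_coord T H (grid_time N i) k ^+ 2 + cos_coord T H (grid_time N i) k ^+ 2)))).
      rewrite !big_split/= -!mulr_sumr (orth1 _ iN) -/msum -/vsum.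
      by move: msum vsum => x y; field.
    by move=> k _; ring.
  rewrite lee_fin.
  have msum_ge : mean_const * r <= msum by exact: tilt_coord_mean.
  have vsum_le : vsum <= variance_const * r ^+ 2.
    have Nn' : (N <= n)%N by lia.
    apply: (@le_trans _ _ (4 * (S ^+ 2 / (2 * H) * r ^+ 2))); last first.
      by rewrite le_eqVlt /variance_const; apply/orP; left; apply/eqP; field; rewrite gt_eqF.
    apply: (@le_trans _ _ (4 * \sum_(N.+1 <= k < n.+1) amplitude T H k ^+ 2)).
      by rewrite mulr_sumr; apply: ler_sum => k _; exact: coord_sqr_le.
    by rewrite ler_wpM2l// sum_amplitude_tail.
  have expo : b * a - l * b * msum + b ^+ 2 * vsum / 2 <= - (l ^+ 2 * chernoff_const).
    have -> : - (l ^+ 2 * chernoff_const) = b * a - l * b * (mean_const * r) +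
        b ^+ 2 * (variance_const * r ^+ 2) / 2.
      rewrite /a /threshold -/l -/r /b /chernoff_const.
      move: (mean_const) (variance_const) mc0 vc0 => x y x0 y0.
      by field; rewrite !gt_eqF.
    rewrite lerD ?ler_pM2r ?invr_gt0//.
      by rewrite lerD2l lerN2 ler_wpM2l// mulr_ge0.
    by rewrite ler_wpM2l// sqr_ge0.
  have l2_ge : 2 <= l ^+ 2 * chernoff_const.
    have c0 := chernoff_const_gt0.
    rewrite -ler_pdivrMr// l2 /base_tilt -addrA lerDl addr_ge0// ln_ge0//.
    by rewrite ler1n -(ltr0n R).
  apply: (@le_trans _ _ (expR (- 2))); first by rewrite ler_expR; lra.
  rewrite expRN lef_pV2 ?posrE ?expR_gt0//.
  have e1 := expR_ge1Dx (1 : R).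
  have -> : expR 2 = expR 1 * expR 1 :> R by rewrite -expRD; congr expR; lra.
  have : 2 <= expR 1 :> R by lra.
  by nra.
- move=> i j; rewrite !mem_s => iN jN.
  under eq_integral => w _.
    rewrite (_ : e i w * e j w = expR (- l ^+ 2 + gaussian_sum Z
      (fun k => l * tilt_coord N i k + l * tilt_coord N j k)
      (fun k => l * 0 + l * 0) N.+1 n.+1 w)); last first.
      by rewrite gaussian_sumD !gaussian_sumZ /e -/(U i w) -/(U j w) -expRD; congr expR; field.
    over.
  rewrite (@integral_expR_affine _ (l ^+ 2 * (i == j)%:R))//.
    by case: eqVneq; rewrite ?mulr1 ?mulr0 ?expR0.
  rewrite (eq_bigr (fun k => l ^+ 2 * (tilt_coord N i k * tilt_coord N i k) +
    (2 * l ^+ 2 * (tilt_coord N i k * tilt_coord N j k) +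
     l ^+ 2 * (tilt_coord N j k * tilt_coord N j k)))); last by move=> k _; ring.
  rewrite !big_split/= -!mulr_sumr (orth1 _ iN) (orth1 _ jN) orth//.
  by move: ((i == j)%:R : R) => x; field.
- move=> w i Aw; rewrite mem_s => iN; rewrite /e /g ler_expR lerDl mulr_ge0//.
  by rewrite subr_ge0 leNgt; apply/negP => aX; apply: Aw; exists i.
Qed.

End lower_probability.

(** * The lower bound in expectation *)

Section lower_bound.
Context (R : realType) (T H s S : R).
Hypotheses (T_gt0 : 0 < T) (H_gt0 : 0 < H) (s_gt0 : 0 < s) (S_gt0 : 0 < S).
Hypothesis amp_le : forall k, (0 < k)%N -> amplitude T H k <= S * k%:R `^ (- (H + 2^-1)).
Hypothesis amp_ge : forall k, (2 <= k)%N -> s * k%:R `^ (- (H + 2^-1)) <= amplitude T H k.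

(** With [r] the square root of the ratio, [m.+1%:R * r ^+ m] stays bounded while
    [r ^+ m] tends to zero. *)
Lemma dyadic_rate_vanishes (e : R) (M : nat) : 0 < e ->
  exists2 m, (M <= m)%N & Num.sqrt m.+1%:R / block_rate H m <= e.
Proof.
move=> e0; pose r : R := Num.sqrt (2 `^ H)^-1.
have p1 : 1 < 2 `^ H :> R.
  have := gt0_ltr_powR H_gt0; move=> /(_ 1 2); rewrite powR1; apply.
  - by rewrite nnegrE.
  - by rewrite nnegrE.
  - by rewrite ltr1n.
have r0 : 0 < r by rewrite sqrtr_gt0 invr_gt0 powR_gt0.
have r1 : r < 1.
  by rewrite -[ltRHS]sqrtr1 ltr_sqrt// invf_lt1// (lt_trans _ p1).
pose B : R := ((1 - r) ^+ 2)^-1.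
have B0 : 0 < B by rewrite invr_gt0 exprn_gt0// subr_gt0.
have term_le m : m.+1%:R * r ^+ m <= B.
  apply: le_trans (sum_arith_geometric_le m.+1 r0 r1).
  rewrite big_nat_recr//= lerDr sumr_ge0// => i _.
  by rewrite mulr_ge0// exprn_ge0// ltW.
have [M' _ hM'] : \forall m \near \oo, r ^+ m < e / B.
  have : r ^+ m @[m --> \oo] --> (0 : R).
    by apply: cvg_expr; rewrite gtr0_norm.
  by move=> /cvgr_lt; apply; rewrite divr_gt0.
exists (maxn M M'); first exact: leq_maxl.
set m := maxn M M'.
rewrite inv_block_rate//.
have -> : (2 `^ H)^-1 ^+ m = r ^+ m * r ^+ m :> R.
  by rewrite -exprMn -expr2 sqr_sqrtr// invr_ge0 powR_ge0.
have rm : r ^+ m <= e / B by apply/ltW/hM'; exact: leq_maxr.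
rewrite mulrA (@le_trans _ _ (B * (e / B)))//; last by rewrite mulrCA mulfV ?mulr1// gt_eqF.
apply: ler_pM => //.
- by rewrite mulr_ge0 ?sqrtr_ge0// exprn_ge0// ltW.
- by rewrite exprn_ge0// ltW.
apply: le_trans (term_le m); rewrite ler_wpM2r ?exprn_ge0 ?(ltW r0)//.
have : Num.sqrt m.+1%:R <= Num.sqrt (m.+1%:R ^+ 2) :> R.
  by rewrite ler_wsqrtr// expr2 ler_peMl// ler1n.
by rewrite sqrtr_sqr ger0_norm.
Qed.

(** As [N <= 2 * N.-1] and [ln 2 <= 1 <= base_tilt], the square of the tilt level
    is at least [ln N]. *)
Lemma threshold_ge N : (2 <= N)%N ->
  mean_const H s / 2 * (N%:R `^ (- H) * Num.sqrt (ln N%:R)) <= threshold H s S N.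
Proof.
move=> N2; have mc0 := mean_const_gt0 H s_gt0.
rewrite /threshold; set x := N%:R `^ (- H); set y := Num.sqrt _.
have -> : tilt_level H s S N * mean_const H s * x / 2 =
   mean_const H s / 2 * (x * tilt_level H s S N) by ring.
apply: ler_wpM2l; first by rewrite divr_ge0// ltW.
apply: ler_wpM2l; first exact: powR_ge0.
apply: ler_wsqrtr.
have b1 : 1 <= base_tilt H s S.
  rewrite /base_tilt lerDr divr_ge0// ltW//.
  exact: chernoff_const_gt0.
have N1 : 0 < N.-1%:R :> R by rewrite ltr0n; lia.
have ln_le : ln N%:R <= 1 + ln N.-1%:R :> R.
  have h : ln 2 <= 1 :> R by have := @le_ln1Dx R 1; rewrite (_ : 1 + 1 = 2)//; apply; lra.
  apply: (@le_trans _ _ (ln 2 + ln N.-1%:R)); last by rewrite lerD2r.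
  rewrite -lnM ?posrE// ler_ln ?posrE ?mulr_gt0//; last by rewrite ltr0n ltnW.
  by rewrite -natrM ler_nat; lia.
by apply: (le_trans ln_le); rewrite lerD2r.
Qed.

Context d (Omega : measurableType d) (P : probability Omega R).
Variable Z : int -> {RV P >-> R}.
Hypothesis indepZ : mutually_independent Z.
Hypothesis gaussZ : forall k, standard_gaussian (Z k).

(** The error at a grid time differs from the finite sum up to frequency [2 ^ m]
    by at most [2 * tail_bound m].  The function [h] is a measurable minorant
    of [sup_error], a supremum over uncountably many times. *)
Lemma integral_sup_error_ge_tail N m : (2 <= N)%N -> (N.*2 <= 2 ^ m)%N ->
  ((threshold H s S N / (2 * overlap_const H s S))%:E <=
   \int[P]_w sup_error T H Z N w + 2%:E * \int[P]_w tail_bound T H S Z m w)%E.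
Proof.
move=> N2 Nm.
set a := threshold H s S N; set V := tail_bound T H S Z m.
set A := \bigcup_(i in [set i | (0 < i < N)%N])
        [set w | a < increment T H Z (grid_time T N i) N (2 ^ m) w].
have PA := grid_maximum_prob T_gt0 H_gt0 s_gt0 S_gt0 amp_le amp_ge indepZ gaussZ N2 Nm.
rewrite -/a -/A in PA.
have a0 : 0 <= a.
  apply: le_trans (threshold_ge N2).
  by rewrite !mulr_ge0 ?powR_ge0 ?sqrtr_ge0// ltW// mean_const_gt0.
have V0 w : (0 <= V w)%E by exact: tail_bound_ge0.
have mV : measurable_fun [set: Omega] V by exact: measurable_tail_bound.
have mA : measurable A.
  apply: bigcup_measurable => i _.
  have -> : [set w | a < increment T H Z (grid_time T N i) N (2 ^ m) w] =
      [set: Omega] `&` increment T H Z (grid_time T N i) N (2 ^ m) @^-1` `]a, +oo[.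
    by apply/seteqP; split=> w /=; rewrite in_itv/= andbT; [split|case].
  exact: measurable_gaussian_sum.
pose h w : \bar R := (maxe ((a * \1_A w)%:E - 2%:E * V w) 0)%E.
have mI : measurable_fun [set: Omega] (fun w => (a * \1_A w)%:E : \bar R).
  by apply/measurable_EFinP; apply: measurable_funM => //; exact: measurable_indic.
have mh : measurable_fun [set: Omega] h.
  apply: measurable_maxe => //; apply: emeasurable_funB => //.
  exact: measurable_funeM.
have h0 w : (0 <= h w)%E by rewrite le_max lexx orbT.
have hV w : ((a * \1_A w)%:E <= h w + 2%:E * V w)%E.
  have [Vw|] := ltP (V w) +oo%E; last first.
    rewrite leye_eq => /eqP ->; rewrite gt0_muley ?lte_fin// addey ?leey//.
    by rewrite gt_eqF// (lt_le_trans _ (h0 w)).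
  have Vfin : V w \is a fin_num by rewrite ge0_fin_numE.
  rewrite -leeBlDr ?fin_numM//.
  by rewrite le_max lexx.
have h_le w : (h w <= sup_error T H Z N w)%E.
  have se0 : (0 <= sup_error T H Z N w)%E by exact: sup_error_ge0.
  rewrite /h ge_max se0 andbT.
  have [Vw|] := ltP (V w) +oo%E; last first.
    by rewrite leye_eq => /eqP ->; rewrite gt0_muley ?lte_fin// addeNy leNye.
  have Vfin : V w \is a fin_num by rewrite ge0_fin_numE.
  rewrite indicE; have [/set_mem Aw|_] := boolP (w \in A); last first.
    by rewrite mulr0 sub0e (le_trans _ se0)// oppe_le0 mule_ge0// lee_fin.
  case: Aw => i /= /andP[i0 iN] aX; rewrite mulr1.
  have tT : 0 <= grid_time T N i <= T.
    have N0 : 0 < N%:R :> R by rewrite ltr0n ltnW.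
    rewrite /grid_time divr_ge0 ?mulr_ge0 ?(ltW T_gt0)//=.
    by rewrite ler_pdivrMr// mulrC ler_pM2l// ler_nat ltnW.
  apply: (@le_trans _ _ (`|limit_process T H Z (grid_time T N i) w -
      partial_process T H Z N (grid_time T N i) w|)%:E); last first.
    by apply: ereal_sup_ubound; exists (grid_time T N i) => //=; rewrite in_itv.
  have m2 : (2 ^ m <= 2 ^ m <= 2 ^ m.+1)%N by rewrite leqnn leq_pexp2l.
  have V00 : (tail_bound T H S Z 0 w < +oo)%E by exact: tail_bound_lty Vw.
  have := limit_dist_tail T_gt0 H_gt0 S_gt0 amp_le tT m2 V00.
  rewrite -/V -(fineK Vfin) -!EFinM -EFinB !lee_fin => ld.
  rewrite -incrementE in aX; last by lia.
  move: aX ld; set lp := limit_process _ _ _ _ _; set p1 := partial_process _ _ _ _ _ _.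
  set p2 := partial_process _ _ _ _ _ _ => aX ld.
  have := ler_norm (lp - p2); have := ler_norm (p1 - lp); rewrite (distrC p1) => h1 h2.
  by lra.
apply: (@le_trans _ _ (\int[P]_w (a * \1_A w)%:E)%E).
  rewrite (_ : \int[P]_w _ = a%:E * P A)%E; last first.
    under eq_integral do rewrite EFinM.
    rewrite ge0_integralZl//; last first.
      by apply/measurable_EFinP; exact: measurable_indic.
    by rewrite integral_indic// setIT.
  by rewrite EFinM lee_wpmul2l// lee_fin.
apply: (@le_trans _ _ (\int[P]_w (h w + 2%:E * V w))%E).
  apply: ge0_le_integral => //.
  - by move=> w _; rewrite lee_fin mulr_ge0// indicE.
  - apply: emeasurable_funD => //; exact: measurable_funeM.
rewrite ge0_integralD//; last 2 first.
- by move=> w _; rewrite mule_ge0// lee_fin.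
- exact: measurable_funeM.
rewrite ge0_integralZl//.
by rewrite leeD2r// ge0_le_integral_nonmeasurable.
Qed.

Definition lower_const : R := mean_const H s / 2 / (2 * overlap_const H s S).

Lemma lower_const_gt0 : 0 < lower_const.
Proof.
rewrite /lower_const !divr_gt0 ?mean_const_gt0// mulr_gt0// addr_gt0// expR_gt0.
by [].
Qed.

(** Let the truncation level [m] tend to infinity. *)
Lemma integral_sup_error_ge N : (2 <= N)%N ->
  ((lower_const * (N%:R `^ (- H) * Num.sqrt (ln N%:R)))%:E <=
   \int[P]_w sup_error T H Z N w)%E.
Proof.
move=> N2; apply: (@le_trans _ _ (threshold H s S N / (2 * overlap_const H s S))%:E).
  have oc : 0 < 2 * overlap_const H s S by rewrite mulr_gt0// addr_gt0// expR_gt0.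
  rewrite lee_fin /lower_const mulrAC ler_pM2r ?invr_gt0//.
  exact: threshold_ge.
apply/lee_addgt0Pr => e e0.
pose K := 2 * (1 + tail_const H S).
have tc0 : 0 <= tail_const H S by exact: tail_const_ge0.
have K0 : 0 < K by rewrite mulr_gt0// ltr_pwDl.
have [m Nm rate_le] := dyadic_rate_vanishes N.*2 (divr_gt0 e0 K0).
have N2m : (N.*2 <= 2 ^ m)%N by rewrite (leq_trans Nm)// ltnW// ltn_expl.
apply: (le_trans (integral_sup_error_ge_tail N2 N2m)).
rewrite leeD2l//.
apply: (@le_trans _ _ (2%:E * (tail_const H S * (e / K))%:E)%E).
  rewrite lee_wpmul2l ?lee_fin//.
  apply: (le_trans (integral_tail_bound _ _ _ amp_le indepZ gaussZ m)) => //.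
  by rewrite lee_fin ler_wpM2l.
rewrite -EFinM lee_fin -[leRHS](divfK (lt0r_neq0 K0)) mulrA [leRHS]mulrC.
by rewrite ler_pM2r ?divr_gt0// /K ler_pM2l// lerDr.
Qed.

End lower_bound.

Theorem proposition3p6 (R : realType) (T H : R)
  (T_gt0 : 0 < T) (H_gt0 : 0 < H) (H_lt1 : H < 1) (H_neq : H != 2^-1) :
  exists c C : R, 0 < c /\ c <= C /\
    forall (d : measure_display) (Omega : measurableType d)
      (P : probability Omega R) (Z : int -> {RV P >-> R}),
      mutually_independent Z ->
      (forall k : int, standard_gaussian (Z k)) ->
      {ae P, forall w : Omega,
         {uniform `[0, T], (fun N t => partial_process T H Z N t w) @ \oo -->
                           (fun t => limit_process T H Z t w)}} /\
      (forall N : nat, (2 <= N)%N ->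
         ((c * (N%:R `^ (- H) * Num.sqrt (ln N%:R)))%:E
            <= \int[P]_w sup_error T H Z N w)%E /\
         (\int[P]_w sup_error T H Z N w
            <= (C * (N%:R `^ (- H) * Num.sqrt (ln N%:R)))%:E)%E).
Proof.
have [s [S [s_gt0 S_gt0 amp]]] := amplitude_bounds T_gt0 H_gt0 H_lt1 H_neq.
have amp_le k : (0 < k)%N -> amplitude T H k <= S * k%:R `^ (- (H + 2^-1)).
  by move=> k_gt0; have [] := amp k k_gt0.
have amp_ge k : (2 <= k)%N -> s * k%:R `^ (- (H + 2^-1)) <= amplitude T H k.
  by move=> k_ge2; have [_] := amp k (ltnW k_ge2); apply.
(* the maximum guarantees that the two constants are ordered *)
exists (lower_const H s S), (Num.max (lower_const H s S) (upper_const H S)).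
split; first exact: lower_const_gt0.
split; first by rewrite le_max lexx.
move=> d Omega P Z indepZ gaussZ; split.
  have := ae_tail_bound_lty T_gt0 H_gt0 S_gt0 amp_le indepZ gaussZ.
  by apply: filterS => w; exact: partial_process_uniform_cvg.
move=> N N_ge2; split.
  exact: (integral_sup_error_ge T_gt0 H_gt0 s_gt0 S_gt0 amp_le amp_ge indepZ gaussZ).
have := integral_sup_error_le T_gt0 H_gt0 S_gt0 amp_le indepZ gaussZ N_ge2.
move=> /le_trans; apply; rewrite lee_fin ler_wpM2r ?mulr_ge0 ?powR_ge0 ?sqrtr_ge0//.
by rewrite le_max lexx orbT.
Qed.
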